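(* For every $\varepsilon>0$ there exists a $2$-dimensional Riemannian manifold $(M,g)$ with a pole $o\in M$ whose Gaussian curvature $K$ satisfies, for some constant $C>0$, $$K(x)\sim -C\, r(x)^{2+\varepsilon}\qquad\text{as } r(x)\to+\infty,$$ where $r(x)$ denotes the Riemannian distance from $o$ to $x$, and such that the $L^1$-positivity preserving property fails on $M$.
   Context: $\Delta=\operatorname{div}\nabla$ denotes the (negatively defined) Laplace-Beltrami operator of $(M,g)$ and $d\mu_g$ the Riemannian measure. A function $u\in L^1_{\mathrm{loc}}(M)$ satisfies $(-\Delta+1)u\ge 0$ in the sense of distributions if $\int_M u\,(-\Delta+1)\varphi\, d\mu_g\ge 0$ for all $\varphi\in C^\infty_c(M)$ with $\varphi\ge 0$. $(M,g)$ has the $L^1$-positivity preserving property if every $u\in L^1(M)$ satisfying $(-\Delta+1)u\ge 0$ in the sense of distributions is non-negative almost everywhere. The notation $f\sim h$ as $r(x)\to+\infty$ means $f(x)/h(x)\to 1$ as $r(x)\to+\infty$. A pole is a point $o$ such that $\exp_o:T_oM\to M$ is a diffeomorphism. *)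

(* Defs.v *)
From HB Require Import structures.
From mathcomp Require Import all_boot all_order all_algebra.
From mathcomp Require Import all_classical all_reals all_analysis.
From mathcomp Require Import measurable_realfun.

Set Implicit Arguments.
Unset Strict Implicit.
Unset Printing Implicit Defensive.

Import Order.TTheory GRing.Theory Num.Theory.
Import numFieldNormedType.Exports.

Local Open Scope classical_set_scope.
Local Open Scope ring_scope.

(** Riemannian surfaces that are diffeomorphic to the plane, in a global chart.
    If a Riemannian surface [M] has a pole [o], then [exp_o : T_oM -> M] is a
    diffeomorphism from a plane, so [M] is isometric to [R * R] equipped with
    some smooth metric; hence nothing is lost by taking [R * R] as the
    underlying manifold.  The metric is an arbitrary smooth field of symmetric
    positive definite matrices, each tangent space is identified with [R * R]
    by the coordinate frame, and the geometric objects below are given by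
    their expressions in the coordinates. *)

Definition coordinate (R : realType) (i : 'I_2) (v : R * R) : R :=
  if i == ord0 then v.1 else v.2.

Definition frame (R : realType) (i : 'I_2) : R * R :=
  ((i == ord0)%:R, (i != ord0)%:R).

Definition vec_of (R : realType) (c : 'I_2 -> R) : R * R :=
  (c ord0, c ord_max).

Definition partial (R : realType) (W : normedModType R) (i : 'I_2)
    (f : R * R -> W) (p : R * R) : W :=
  derive f p (frame R i).

Fixpoint Ck (R : realType) (W : normedModType R) (k : nat)
    (f : R * R -> W) : Prop :=
  if k is k'.+1 then
    [/\ continuous f,
        forall i p, derivable f p (frame R i) &
        forall i, Ck k' (partial i f)]
  else continuous f.

Definition smooth (R : realType) (W : normedModType R) (f : R * R -> W) : Prop :=
  forall k, Ck k f.

Definition diffeomorphism (R : realType) (f : R * R -> R * R) : Prop :=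
  smooth f /\ exists h : R * R -> R * R, [/\ smooth h, cancel f h & cancel h f].

Definition inner (R : realType) (A : 'M[R]_2) (v w : R * R) : R :=
  \sum_i \sum_j A i j * coordinate i v * coordinate j w.

Record riemannian_metric (R : realType) := RiemannianMetric {
  metric_mx :> R * R -> 'M[R]_2 ;
  metric_sym : forall p i j, metric_mx p i j = metric_mx p j i ;
  metric_pos : forall p v, v != 0 -> 0 < inner (metric_mx p) v v ;
  metric_smooth : forall i j, smooth (fun p => metric_mx p i j)
}.

Definition sqrt_det (R : realType) (g : riemannian_metric R) (p : R * R) : R :=
  Num.sqrt (\det (g p)).

Definition inv_metric (R : realType) (g : riemannian_metric R) (i j : 'I_2)
    (p : R * R) : R :=
  invmx (g p) i j.

(** [christoffel g k i j] is Gamma^k_ij of the Levi-Civita connection. *)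
Definition christoffel (R : realType) (g : riemannian_metric R)
    (k i j : 'I_2) (p : R * R) : R :=
  2^-1 * \sum_l inv_metric g k l p *
    (partial i (fun q => g q j l) p + partial j (fun q => g q i l) p
     - partial l (fun q => g q i j) p).

(** The coefficient on the [l]-th frame vector of R(d_i, d_j) d_k, where
    R(X, Y) Z = nabla_X nabla_Y Z - nabla_Y nabla_X Z - nabla_[X, Y] Z. *)
Definition riemann_tensor (R : realType) (g : riemannian_metric R)
    (l k i j : 'I_2) (p : R * R) : R :=
  partial i (christoffel g l j k) p - partial j (christoffel g l i k) p
  + \sum_m (christoffel g l i m p * christoffel g m j k p
            - christoffel g l j m p * christoffel g m i k p).

(** <R(d_0, d_1) d_1, d_0> / (|d_0|^2 |d_1|^2 - <d_0, d_1>^2) *)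
Definition gauss_curvature (R : realType) (g : riemannian_metric R)
    (p : R * R) : R :=
  (\sum_l g p ord0 l * riemann_tensor g l ord_max ord0 ord_max p) / \det (g p).

Definition geodesic (R : realType) (g : riemannian_metric R)
    (c : R -> R * R) : Prop :=
  forall t, [/\ derivable c t 1, derivable (derive1 c) t 1 &
    forall k, coordinate k (derive1 (derive1 c) t)
      + \sum_i \sum_j christoffel g k i j (c t)
          * coordinate i (derive1 c t) * coordinate j (derive1 c t) = 0].

(** The graph of [exp_o]: [exp_at g o v q] means that exp_o(v) is defined and
    equal to [q].  A geodesic with given initial data is unique, and exp_o is
    defined on all of T_oM iff the geodesics issued from [o] are defined on
    all of [R]. *)
Definition exp_at (R : realType) (g : riemannian_metric R)
    (o v q : R * R) : Prop :=
  exists c : R -> R * R, [/\ geodesic g c, c 0 = o, derive1 c 0 = v & c 1 = q].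

Definition is_pole (R : realType) (g : riemannian_metric R) (o : R * R) : Prop :=
  exists2 E : R * R -> R * R,
    (forall v, exp_at g o v (E v)) & diffeomorphism E.

Definition curve_length (R : realType) (g : riemannian_metric R)
    (c : R -> R * R) : R :=
  \int[lebesgue_measure]_(t in `[0, 1])
    Num.sqrt (inner (g (c t)) (derive1 c t) (derive1 c t)).

(** A piecewise C^1 curve from [p] to [q] is a finite concatenation of C^1
    curves, each parametrized by [0, 1].  The pieces are functions on [R]
    since a C^1 function on [0, 1] always extends to a C^1 function on [R]. *)
Fixpoint piecewise_C1_curve (R : realType) (p q : R * R)
    (s : seq (R -> R * R)) : Prop :=
  if s is c :: s' then
    [/\ forall t, derivable c t 1, continuous (derive1 c), c 0 = p &
        piecewise_C1_curve (c 1) q s']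
  else p = q.

Definition riemannian_distance (R : realType) (g : riemannian_metric R)
    (p q : R * R) : R :=
  inf [set L | exists2 s : seq (R -> R * R),
         piecewise_C1_curve p q s & L = \sum_(c <- s) curve_length g c].

Definition gradient (R : realType) (g : riemannian_metric R)
    (f : R * R -> R) (p : R * R) : R * R :=
  vec_of (fun i => \sum_j inv_metric g i j p * partial j f p).

Definition divergence (R : realType) (g : riemannian_metric R)
    (X : R * R -> R * R) (p : R * R) : R :=
  (sqrt_det g p)^-1 *
    \sum_i partial i (fun q => sqrt_det g q * coordinate i (X q)) p.

Definition laplace_beltrami (R : realType) (g : riemannian_metric R)
    (f : R * R -> R) : R * R -> R :=
  divergence g (gradient g f).

(** The Riemannian measure: density sqrt(det g) with respect to the Lebesgue
    measure of the coordinate plane. *)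
Definition riemannian_measure (R : realType) (g : riemannian_metric R)
    (A : set (measurableTypeR R * measurableTypeR R)) : \bar R :=
  (\int[lebesgue_measure \x lebesgue_measure]_(p in A) (sqrt_det g p)%:E)%E.

Lemma open_measurable_plane (R : realType) (U : set (R * R)) :
  open U -> @measurable _ (measurableTypeR R * measurableTypeR R)%type U.
Proof.
move=> oU.
pose B (x : (rat * rat) * rat) : set (R * R) :=
  ball (ratr x.1.1 : R) (ratr x.2) `*` ball (ratr x.1.2 : R) (ratr x.2).
have -> : U = \bigcup_(x in [set x | B x `<=` U]) B x.
  apply/seteqP; split; last by move=> p [x /= BU]; exact: BU.
  move=> [a b] Uab.
  have /nbhs_ballP[e /= e0 eU] : nbhs (a, b) U.
    by apply: open_nbhs_nbhs; split.
  have [r] : exists r : rat, e / 4 < ratr r < e / 2.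
    have lt42 : e / 4 < e / 2 by rewrite ltr_pM2l// ltf_pV2 ?posrE ?ltr_nat.
    have [r] := rat_in_itvoo lt42.
    by rewrite in_itv/= => ?; exists r.
  move=> /andP[r1 r2].
  have r0 : 0 < ratr r :> R by apply: lt_trans r1; rewrite divr_gt0.
  have H (c : R) : exists q : rat, `|c - ratr q| < ratr r.
    have crr : c - ratr r < c + ratr r.
      by rewrite ltrBlDr -addrA ltrDl addr_gt0.
    have [q] := rat_in_itvoo crr.
    by rewrite in_itv/= -ltr_distl distrC => ?; exists q.
  have [qa ha] := H a; have [qb hb] := H b.
  exists ((qa, qb), r); last by split => /=; rewrite /ball/= distrC.
  move=> [x y] [/= hx hy]; apply: eU; split => /=.
    rewrite /ball/= (le_lt_trans (ler_distD (ratr qa) _ _))//.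
    by rewrite [ltRHS](splitr e) ltrD// (lt_trans _ r2).
  rewrite /ball/= (le_lt_trans (ler_distD (ratr qb) _ _))//.
  by rewrite [ltRHS](splitr e) ltrD// (lt_trans _ r2).
rewrite bigcup_mkcond; apply: countable_bigcupT_measurable => // x.
by case: ifPn => // _; apply: measurableX; exact: measurable_ball.
Qed.

Lemma continuous_sqrt_det (R : realType) (g : riemannian_metric R) :
  continuous (sqrt_det g).
Proof.
have cg i j : continuous (fun p => g p i j) by exact: (metric_smooth g i j 0).
move=> p; apply: continuous_comp; last exact: sqrt_continuous.
apply: continuous_big => [|s _].
  exact: add_continuous.
move=> q; apply: cvgM; first exact: cvg_cst.
apply: cvg_big => [|i _]; first exact: mul_continuous.
exact: cg.
Qed.

Lemma measurable_sqrt_det (R : realType) (g : riemannian_metric R) :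
  measurable_fun [set: measurableTypeR R * measurableTypeR R] (sqrt_det g).
Proof.
apply: (measurability _ (RGenOpens.measurableE R)).
move=> _ [_ [a [b ->] <-]]; rewrite setTI; apply: open_measurable_plane.
apply: open_comp; last exact: interval_open.
by move=> p _; exact: continuous_sqrt_det.
Qed.

Section riemannian_measure_is_measure.
Context (R : realType) (g : riemannian_metric R).

Let riemannian_measure0 : riemannian_measure g set0 = 0%E.
Proof. exact: integral_set0. Qed.

Let riemannian_measure_ge0 A : (0 <= riemannian_measure g A)%E.
Proof. by apply: integral_ge0 => p _; rewrite lee_fin sqrtr_ge0. Qed.

Let riemannian_measure_sigma_additive :
  semi_sigma_additive (riemannian_measure g).
Proof.
apply: semi_sigma_additive_nng_induced.
  by apply/measurable_EFinP; exact: measurable_sqrt_det.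
by move=> p; rewrite lee_fin sqrtr_ge0.
Qed.

HB.instance Definition _ := isMeasure.Build _ _ _ (riemannian_measure g)
  riemannian_measure0 riemannian_measure_ge0 riemannian_measure_sigma_additive.

End riemannian_measure_is_measure.

Definition test_function (R : realType) (phi : R * R -> R) : Prop :=
  smooth phi /\ compact (closure [set x | phi x != 0]).

(** (-Delta + 1) u >= 0 in the sense of distributions; meant for locally
    integrable [u], for which the integrands below are integrable. *)
Definition distributional_supersolution (R : realType)
    (g : riemannian_metric R) (u : R * R -> R) : Prop :=
  forall phi : R * R -> R, test_function phi -> (forall x, 0 <= phi x) ->
    0 <= \int[riemannian_measure g]_x
           (u x * (- laplace_beltrami g phi x + phi x)).

Definition L1_positivity_preserving (R : realType)
    (g : riemannian_metric R) : Prop :=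
  forall u : R * R -> R,
    (riemannian_measure g).-integrable setT (EFin \o u) ->
    distributional_supersolution g u ->
    {ae riemannian_measure g, forall x, 0 <= u x}.

(** f ~ h as r -> +oo, along the filter generated by the sets {r > A}. *)
Definition asymptotically_equivalent (R : realType) (T : Type)
    (r f h : T -> R) : Prop :=
  f x / h x @[x --> filter_from [set: R] (fun A => [set x | A < r x])] --> (1 : R).

(* Main.v *)
Require Import Defs.
From HB Require Import structures.
From mathcomp Require Import all_boot all_order all_algebra.
From mathcomp Require Import all_classical all_reals all_analysis.
From mathcomp Require Import measurable_realfun ring lra.
Import Order.TTheory GRing.Theory Num.Theory.
Import numFieldNormedType.Exports.
Local Open Scope classical_set_scope.
Local Open Scope ring_scope.
Set Implicit Arguments.
Unset Strict Implicit.
Unset Printing Implicit Defensive.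

(** In polar coordinates around a pole, a rotationally symmetric surface is
    dr^2 + j(r)^2 dtheta^2 and has curvature -j''/j.  Take j(r) = r f(r^2) with
    f(s) = exp (1 - (1 + s)^(1 + a)) and a = eps / 4.  Then j decays so fast
    that the area is finite, while still K ~ - 4 (1 + a)^2 r^(2 + 4 a).
    A radial w satisfies Delta w = j^-1 (j w')', so a solution of Delta w = w
    has j w' convergent and w grows like the integral of 1/j, hence like 1/|j'|.
    Thus j w is comparable to j/|j'|, i.e. to r^(-1 - 2 a), and w is integrable.
    An explicit function W of this size satisfies Delta W >= W - M for a large
    constant M, so u = M - W is an L^1 function with (- Delta + 1) u >= 0 that
    tends to - oo at infinity. *)

(** * Derivatives and C^k functions on the plane *)

(** The leading term of -j''/j is the same for a growing and for a decaying exponential profile;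
    decay is chosen because constants are then integrable, so that M - W stays in L^1. The constant
    M is there because comparing leading orders gives Delta W >= W only outside a disc; on the disc
    f is bounded below, and the term f M absorbs the defect.

    The hypothesis a > 0, that is, growth faster than quadratic, enters as the integrability of
    r^(-1 - 2 a) at infinity.

    Polar coordinates degenerate at the pole, where the metric and u still have to be smooth.
    Everything is therefore done in Cartesian coordinates with functions of s = |p|^2; they are
    differentiated on a neighborhood of 0 in s, hence the recurring condition -1 < s. The only
    quotient by s is the metric coefficient (f^2 - 1) / s, which is why Hadamard's lemma appears.

    Since u is smooth, the distributional inequality reduces to a pointwise one by Green's
    identity. *)

(* The library states these rules for sums and products in the ring of
   functions; the pointwise forms below unify with explicit lambda terms. *)
Section derivation_rules.
Context {R : realType} {V : normedModType R}.
Implicit Types (f g : V -> R) (x v : V).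

Lemma isD_val (W : normedModType R) (f : V -> W) x v (d e : W) :
  is_derive x v f d -> d = e -> is_derive x v f e.
Proof. by move=> ? <-. Qed.

Lemma isD_add f g x v (a b : R) : is_derive x v f a -> is_derive x v g b ->
  is_derive x v (fun y => f y + g y) (a + b).
Proof. by move=> ? ?; exact: is_deriveD. Qed.

Lemma isD_opp f x v (a : R) : is_derive x v f a ->
  is_derive x v (fun y => - f y) (- a).
Proof. by move=> ?; exact: is_deriveN. Qed.

Lemma isD_mul f g x v (a b : R) : is_derive x v f a -> is_derive x v g b ->
  is_derive x v (fun y => f y * g y) (a * g x + f x * b).
Proof.
move=> ? ?; have -> : a * g x + f x * b = f x *: b + g x *: a.
  by rewrite addrC [a * _]mulrC.
exact: is_deriveM.
Qed.

Lemma isD_cst x v (c : R) : is_derive x v (fun=> c) 0.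
Proof. exact: is_derive_cst. Qed.

(** Restricting to the line [h *: v + x] reduces this to the chain rule on the real line. Only a
    derivative of [f] in the direction [v] is assumed, which matches the construction of [Ck] from
    directional derivatives. *)
Lemma isD_comp f (G : R -> R) x v (a c : R) :
  is_derive (f x) 1 G c -> is_derive x v f a ->
  is_derive x v (fun y => G (f y)) (c * a).
Proof.
move=> [dG <-] [df <-].
have df1 : derivable (fun h : R => f (h *: v + x)) 0 1 by exact: (derivable1P _ _ _).1.
have f0 : f (0 *: v + x) = f x by rewrite scale0r add0r.
have dG0 : derivable G (f (0 *: v + x)) 1 by rewrite f0.
have E (F : V -> R) : 'D_v F x = derive1 (fun h : R => F (h *: v + x)) 0.
  rewrite derive1E /derive.
  set g1 := fun h => h^-1 *: _; set g2 := fun h => h^-1 *: _.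
  suff -> : g1 = g2 by [].
  by rewrite funeqE /g1 /g2 => h /=; rewrite addr0 scale0r add0r [_%:A]mulr1.
apply: DeriveDef.
  apply/derivable1P/derivable1_diffP.
  apply: (@differentiable_comp _ _ _ _ (fun h : R => f (h *: v + x)) G);
    exact/derivable1_diffP.
rewrite !E (derive1_comp df1 dG0) f0 derive1E mulrC mulrC.
by congr (_ * _); rewrite derive1E.
Qed.

Lemma isD_inv f x v (a : R) : f x != 0 -> is_derive x v f a ->
  is_derive x v (fun y => (f y)^-1) (- a / f x ^+ 2).
Proof.
move=> fx0 [df <-]; apply: DeriveDef; first exact: derivableV.
by rewrite deriveV// /GRing.scale/= mulNr mulNr mulrC.
Qed.

End derivation_rules.

Lemma isD_linear {R : realType} {V W : normedModType R} (f : {linear V -> W})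
  (x v : V) : is_derive x v f (f v).
Proof.
have H : (fun h : R => h^-1 *: ((f \o shift x) (h *: v) - f x)) @ 0^' --> f v.
  apply: cvg_near_cst.
  near=> h; rewrite /= [f (_ + _)]linearD addrK [f (_ *: _)]linearZ/=.
  rewrite scalerA mulVf ?scale1r//.
  by near: h; exact: nbhs_dnbhs_neq.
apply: DeriveDef; first by apply/cvg_ex; exists (f v).
exact: cvg_lim H.
Unshelve. all: by end_near. Qed.

Lemma isD_fst {R : realType} (x v : R * R) : is_derive x v fst v.1.
Proof. exact: (isD_linear fst). Qed.

Lemma isD_snd {R : realType} (x v : R * R) : is_derive x v snd v.2.
Proof. exact: (isD_linear snd). Qed.

Section Ck_theory.
Context {R : realType}.
Implicit Types (f g : R * R -> R).

Lemma partial_val (W : normedModType R) i (f : R * R -> W) p d :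
  is_derive p (frame R i) f d -> partial i f p = d.
Proof. by move=> [_ <-]. Qed.

Lemma Ck_continuous (W : normedModType R) k (f : R * R -> W) :
  Ck k f -> continuous f.
Proof. by case: k => [//|k []]. Qed.

Lemma Ck_derive (W : normedModType R) k (f : R * R -> W) i p :
  Ck k.+1 f -> is_derive p (frame R i) f (partial i f p).
Proof. by case=> _ df _; apply: derivableP; exact: df. Qed.

Lemma CkW (W : normedModType R) k (f : R * R -> W) : Ck k.+1 f -> Ck k f.
Proof.
elim: k f => [|k IH] f [cf df pf]//.
by split => // i; apply: IH; exact: pf.
Qed.

Lemma Ck_partial_eq (W : normedModType R) k (f : R * R -> W)
    (f' : 'I_2 -> R * R -> W) : continuous f ->
  (forall i p, is_derive p (frame R i) f (f' i p)) ->
  (forall i, Ck k (f' i)) -> Ck k.+1 f.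
Proof.
move=> cf df ckf'; split => // i.
rewrite (_ : partial i f = f' i)//.
by apply/funext => p; exact: partial_val.
Qed.

Lemma Ck_partial (W : normedModType R) k (f : R * R -> W) i :
  Ck k.+1 f -> Ck k (partial i f).
Proof. by case=> _ _; apply. Qed.

Lemma Ck_cst (W : normedModType R) k (c : W) : Ck k (fun=> c).
Proof.
elim: k c => [|k IH] c; first exact: cst_continuous.
apply: (@Ck_partial_eq _ _ _ (fun _ _ => 0)) => //; first exact: cst_continuous.
Qed.

Lemma Ck_id k : Ck k (fun p : R * R => p).
Proof.
case: k => [|k]; first by move=> p; exact: cvg_id.
apply: (@Ck_partial_eq _ _ _ (fun i _ => frame R i)).
- by move=> p; exact: cvg_id.
- by move=> i; exact: Ck_cst.
Qed.

Lemma Ck_fst k : Ck k (@fst R R).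
Proof.
case: k => [|k]; first by move=> p; exact: cvg_fst.
apply: (@Ck_partial_eq _ _ _ (fun i _ => (frame R i).1)).
- by move=> p; exact: cvg_fst.
- by move=> i p; exact: isD_fst.
- by move=> i; exact: Ck_cst.
Qed.

Lemma Ck_snd k : Ck k (@snd R R).
Proof.
case: k => [|k]; first by move=> p; exact: cvg_snd.
apply: (@Ck_partial_eq _ _ _ (fun i _ => (frame R i).2)).
- by move=> p; exact: cvg_snd.
- by move=> i p; exact: isD_snd.
- by move=> i; exact: Ck_cst.
Qed.

Lemma CkD k f g : Ck k f -> Ck k g -> Ck k (fun p => f p + g p).
Proof.
elim: k f g => [|k IH] f g.
  by move=> cf cg p; apply: cvgD; [exact: cf|exact: cg].
move=> kf kg.
apply: (@Ck_partial_eq _ _ _ (fun i p => partial i f p + partial i g p)).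
- move=> p; apply: cvgD; [exact: (Ck_continuous kf)|exact: (Ck_continuous kg)].
- by move=> i p; apply: isD_add; [exact: Ck_derive kf|exact: Ck_derive kg].
- by move=> i; apply: IH; exact: Ck_partial.
Qed.

Lemma CkM k f g : Ck k f -> Ck k g -> Ck k (fun p => f p * g p).
Proof.
elim: k f g => [|k IH] f g.
  by move=> cf cg p; apply: cvgM; [exact: cf|exact: cg].
move=> kf kg.
apply: (@Ck_partial_eq _ _ _
  (fun i p => partial i f p * g p + f p * partial i g p)).
- move=> p; apply: cvgM; [exact: (Ck_continuous kf)|exact: (Ck_continuous kg)].
- by move=> i p; apply: isD_mul; [exact: Ck_derive kf|exact: Ck_derive kg].
- move=> i; apply: CkD; apply: IH; by [exact: CkW|exact: Ck_partial].
Qed.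

Lemma CkN k f : Ck k f -> Ck k (fun p => - f p).
Proof.
move=> kf; rewrite (_ : (fun p => - f p) = (fun p => -1 * f p)).
  by apply: CkM => //; exact: Ck_cst.
by apply/funext => p; rewrite mulN1r.
Qed.

(** [G n] stands for the n-th derivative of [G 0]: differentiating [G n (f p)] produces
    [G n.+1 (f p)], so the induction carries all [n] at once. The set [D] accommodates powers of
    [1 + x], which are differentiated for -1 < x only. *)
Lemma Ck_comp k (G : nat -> R -> R) (D : set R) f :
  (forall n x, D x -> is_derive x 1 (G n) (G n.+1 x)) ->
  (forall p, D (f p)) -> Ck k f -> Ck k (fun p => G 0%N (f p)).
Proof.
move=> dG Df.
suff H n : Ck k f -> Ck k (fun p => G n (f p)) by exact: H.
have cG m : continuous f -> continuous (fun p => G m (f p)).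
  move=> cf p; apply: continuous_comp; first exact: cf.
  apply: differentiable_continuous; apply/derivable1_diffP.
  by have [] := dG m _ (Df p).
elim: k n => [|k IH] n kf; first exact: cG.
apply: (@Ck_partial_eq _ _ _ (fun i p => G n.+1 (f p) * partial i f p)).
- exact/cG/(Ck_continuous kf).
- by move=> i p; apply: isD_comp; [exact: dG|exact: Ck_derive kf].
- move=> i; apply: CkM; last exact: Ck_partial.
  by apply: IH; exact: CkW.
Qed.

End Ck_theory.

(** * Coordinates, rotated coordinates and the squared norm *)

Section plane_coordinates.
Context {R : realType}.
Implicit Types (p q v : R * R) (i j k : 'I_2).

Lemma ord2P i : i = ord0 \/ i = ord_max.
Proof. by case: i => [[|[|//]] ?]; [left|right]; exact: val_inj. Qed.

Lemma sum_ord2 (V : nmodType) (F : 'I_2 -> V) :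
  \sum_i F i = F ord0 + F ord_max.
Proof.
rewrite big_ord_recl big_ord_recl big_ord0 addr0; congr (_ + F _).
exact: val_inj.
Qed.

Definition sqnorm p : R := p.1 * p.1 + p.2 * p.2.

Definition rot90 i p : R := if i == ord0 then p.2 else - p.1.

Lemma sqnorm_ge0 p : 0 <= sqnorm p.
Proof. by rewrite addr_ge0// -expr2 sqr_ge0. Qed.

Lemma isD_coordinate i p v : is_derive p v (@coordinate R i) (coordinate i v).
Proof. by rewrite /coordinate; case: ifP => _; [exact: isD_fst|exact: isD_snd]. Qed.

Lemma isD_rot i p v : is_derive p v (rot90 i) (rot90 i v).
Proof.
by rewrite /rot90; case: ifP => _; [exact: isD_snd|exact/isD_opp/isD_fst].
Qed.

Lemma isD_sqnorm p v :
  is_derive p v sqnorm (2 * (p.1 * v.1 + p.2 * v.2)).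
Proof.
apply: (isD_val (isD_add (isD_mul (isD_fst p v) (isD_fst p v))
  (isD_mul (isD_snd p v) (isD_snd p v)))); ring.
Qed.

Lemma isD_radial (G : R -> R) (d : R) p v : is_derive (sqnorm p) 1 G d ->
  is_derive p v (fun q => G (sqnorm q)) (d * (2 * (p.1 * v.1 + p.2 * v.2))).
Proof. by move=> dG; apply: isD_comp => //; exact: isD_sqnorm. Qed.

Lemma Ck_coordinate n i : Ck n (@coordinate R i).
Proof. by case: (ord2P i) => ->; [exact: Ck_fst|exact: Ck_snd]. Qed.

Lemma Ck_rot n i : Ck n (rot90 i).
Proof. by case: (ord2P i) => ->; [exact: Ck_snd|exact/CkN/Ck_fst]. Qed.

Lemma Ck_sqnorm n : Ck n sqnorm.
Proof. by apply: CkD; apply: CkM; (exact: Ck_fst || exact: Ck_snd). Qed.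

End plane_coordinates.

(** * Hadamard's lemma *)

Section hadamard.
Context {R : realType}.
Variable G : nat -> R -> R.
Hypothesis dG : forall n (x : R), -1 < x -> is_derive x 1 (G n) (G n.+1 x).

Local Notation mu := (@lebesgue_measure R).

(* The [n]-th derivative of [(G 0 x - G 0 0) / x], extended to [x = 0]. *)
Definition hadamard n x := \int[mu]_(t in `[0, 1]) (t ^+ n * G n.+1 (t * x)).

Lemma gtN1_scale (t x : R) : 0 <= t <= 1 -> -1 < x -> -1 < t * x.
Proof. by move=> /andP[t0 t1] x1; have [?|?] := leP 0 x; nra. Qed.

Lemma isD_hadamard_integrand n (t x : R) : 0 <= t <= 1 -> -1 < x ->
  is_derive x 1 (fun x => t ^+ n * G n.+1 (t * x)) (t ^+ n.+1 * G n.+2 (t * x)).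
Proof.
move=> t01 x1.
have dtx : is_derive x 1 (fun x : R => t * x) t.
  apply: (isD_val (isD_mul (isD_cst x 1 t) (is_derive_id _ _))).
  by rewrite mul0r add0r mulr1.
have := isD_mul (isD_cst x 1 (t ^+ n)) (isD_comp (dG n.+1 (gtN1_scale t01 x1)) dtx).
by move=> /isD_val; apply; rewrite mul0r add0r exprSr mulrAC mulrA.
Qed.

Lemma isD_segment n (t x : R) : 0 <= t <= 1 -> -1 < x ->
  is_derive t 1 (fun t => G n (t * x)) (x * G n.+1 (t * x)).
Proof.
move=> t01 x1.
have dtx : is_derive t 1 (fun t : R => t * x) x.
  apply: (isD_val (isD_mul (is_derive_id _ _) (isD_cst t 1 x))).
  by rewrite mulr0 addr0 mul1r.
rewrite mulrC.
exact: (@isD_comp _ _ (fun t : R => t * x) _ _ _ _ _ (dG n (gtN1_scale t01 x1)) dtx).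
Qed.

Lemma hadamard_integrable n x : -1 < x ->
  mu.-integrable `[0, 1] (EFin \o (fun t => t ^+ n * G n.+1 (t * x))).
Proof.
move=> x1; apply: continuous_compact_integrable; first exact: segment_compact.
apply: derivable_within_continuous => t; rewrite in_itv/= => t01.
have dtn := derivableP (@exprn_derivable R n t 1).
by have [] := isD_mul dtn (isD_segment n.+1 t01 x1).
Qed.

Lemma isD_hadamard n (x : R) : -1 < x ->
  is_derive x 1 (hadamard n) (hadamard n.+1 x).
Proof.
move=> x1.
(* [u] is the midpoint of -1 and [x], so []u, v[] is a neighborhood of [x] away from -1. Adjoining 0
   to get [[c, d]] makes it contain every [t * y] with [t] in [0, 1]; the maximum of [|G n.+2|]
   there dominates the derivative of the integrand. *)
pose u := (x - 1) / 2; pose v := x + 1.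
pose c := Num.min u 0; pose d := Num.max v 0.
have c1 : -1 < c by rewrite /c lt_min /u; apply/andP; split; lra.
have cd : c <= d by rewrite /c /d ge_min !le_max lexx !orbT.
have cG : {within `[c, d], continuous (fun y => `|G n.+2 y|)}.
  apply: continuous_in_subspaceT => y /[!inE]/= /[!in_itv]/= /andP[cy _].
  apply: continuous_comp; last exact: norm_continuous.
  apply/differentiable_continuous/derivable1_diffP.
  by have [] := dG n.+2 (lt_le_trans c1 cy).
have [m mcd mG] := EVT_max cd cG.
set M : R := `|G n.+2 m| in mG.
have Ix : `]u, v[%classic x by rewrite /= in_itv/= /u /v; apply/andP; split; lra.
have uI y : `]u, v[%classic y -> -1 < y.
  by rewrite /= in_itv/= /u => /andP[uy _]; lra.
pose f x t := t ^+ n * G n.+1 (t * x).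
have d1f y t : `]u, v[%classic y -> `[0, 1]%classic t ->
    derive1 (f ^~ t) y = t ^+ n.+1 * G n.+2 (t * y).
  move=> /uI y1 /=; rewrite in_itv/= => t01.
  by have [_] := isD_hadamard_integrand n t01 y1; rewrite derive1E.
have derf y t : `]u, v[%classic y -> `[0, 1]%classic t -> derivable (f ^~ t) y 1.
  move=> /uI y1 /=; rewrite in_itv/= => t01.
  by have [] := isD_hadamard_integrand n t01 y1.
have intf y : `]u, v[%classic y -> mu.-integrable `[0, 1] (EFin \o f y).
  by move=> /uI; exact: hadamard_integrable.
have m01 : measurable (`[0%R, 1%R]%classic : set (measurableTypeR R)).
  exact: measurable_itv.
have ub y t : `]u, v[%classic y -> `[0, 1]%classic t ->
    `|partial1of2 f y t| <= (fun=> M) t.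
  move=> Iy It; rewrite /partial1of2 d1f// normrM normrX.
  move: It Iy; rewrite /= !in_itv/= => /andP[t0 t1] /andP[uy yv].
  rewrite (ger0_norm t0); apply: (@le_trans _ _ (1 * `|G n.+2 (t * y)|)).
    by apply: ler_wpM2r => //; exact: exprn_ile1.
  rewrite mul1r; apply: mG; rewrite in_itv/= /c /d ge_min le_max.
  have [y0|y0] := leP 0 y.
    by apply/andP; split; apply/orP; [right; nra|left; nra].
  by apply/andP; split; apply/orP; [left; nra|right; nra].
have intM : mu.-integrable `[0, 1] (EFin \o (fun=> M)).
  apply: continuous_compact_integrable; first exact: segment_compact.
  by apply: continuous_subspaceT => ?; exact: cvg_cst.
have dF := derivable_under_integral m01 Ix intf derf (fun=> normr_ge0 _) intM ub.
have vF := differentiation_under_integral m01 Ix intf derf (fun=> normr_ge0 _) intM ub.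
apply: DeriveDef; first exact: dF.
rewrite -derive1E vF /hadamard; apply: eq_Rintegral => t /[!inE] It.
by rewrite /partial1of2 d1f.
Qed.

Lemma hadamard_factor x : -1 < x -> x * hadamard 0 x = G 0%N x - G 0%N 0.
Proof.
move=> x1.
have dt (t : R) : 0 <= t <= 1 ->
    is_derive t 1 (fun t => G 0%N (t * x)) (x * G 1%N (t * x)).
  by move=> t01; exact: isD_segment.
have cts : {within `[0, 1], continuous (fun t => G 0%N (t * x))}.
  apply: derivable_within_continuous => t; rewrite in_itv/= => t01.
  by have [] := dt _ t01.
have cts' : {within `[0, 1], continuous (fun t => x * G 1%N (t * x))}.
  apply: derivable_within_continuous => t; rewrite in_itv/= => t01.
  by have [] := isD_mul (isD_cst t 1 x) (isD_segment 1 t01 x1).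
have FTC : (\int[mu]_(t in `[0%R, 1%R]) (x * G 1%N (t * x))%:E =
    (G 0%N (1 * x))%:E - (G 0%N (0 * x))%:E)%E.
  apply: (@continuous_FTC2 _ _ (fun t => G 0%N (t * x))) => //.
  - have [_ cl cr] := (continuous_within_itvP _ ltr01).1 cts.
    split => // t; rewrite in_itv/= => /andP[t0 t1].
    by have [] := dt t; rewrite ?(ltW t0) ?(ltW t1).
  - move=> t; rewrite in_itv/= => /andP[t0 t1].
    by rewrite derive1E; have [] := dt t; rewrite ?(ltW t0) ?(ltW t1).
rewrite /hadamard -RintegralZl//; last first.
  exact: (hadamard_integrable 0 x1).
transitivity (fine ((G 0%N (1 * x))%:E - (G 0%N (0 * x))%:E)%E).
  rewrite -FTC /Rintegral; congr fine; apply: eq_integral => t _.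
  by rewrite expr0 mul1r.
by rewrite mul1r mul0r.
Qed.

End hadamard.

(** * Curves and integrals *)

Lemma Rintegral_derive {R : realType} (F f : R -> R) (a b : R) : a < b ->
  (forall x : R, is_derive x 1 F (f x)) -> continuous f ->
  \int[lebesgue_measure]_(x in `[a, b]) f x = F b - F a.
Proof.
move=> ab dF cf.
have cF : continuous F.
  by move=> x; apply/differentiable_continuous/derivable1_diffP; have [] := dF x.
rewrite /Rintegral (@continuous_FTC2 _ f F)//.
- exact: continuous_subspaceT.
- split=> [x _| |]; first by have [] := dF x.
  + exact/cvg_at_right_filter/cF.
  + exact/cvg_at_left_filter/cF.
- by move=> x _; have [_ <-] := dF x; rewrite derive1E.
Qed.

Section curve_components.
Context {R : realType}.
Variable c : R -> R * R.
Implicit Types t : R.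

Lemma isD_curve1 t : derivable c t 1 ->
  is_derive t 1 (fun u => (c u).1) (derive1 c t).1.
Proof.
move=> dc; rewrite derive1E.
have H : h^-1 *: ((c (h *: 1 + t)).1 - (c t).1) @[h --> 0^'] --> ('D_1 c t).1.
  apply: (@cvg_comp _ _ _ (fun h : R => h^-1 *: ((c \o shift t) (h *: 1) - c t))
    fst _ _ _ dc).
  exact: cvg_fst.
by apply: DeriveDef; [apply/cvg_ex; exists ('D_1 c t).1|exact: cvg_lim H].
Qed.

Lemma isD_curve2 t : derivable c t 1 ->
  is_derive t 1 (fun u => (c u).2) (derive1 c t).2.
Proof.
move=> dc; rewrite derive1E.
have H : h^-1 *: ((c (h *: 1 + t)).2 - (c t).2) @[h --> 0^'] --> ('D_1 c t).2.
  apply: (@cvg_comp _ _ _ (fun h : R => h^-1 *: ((c \o shift t) (h *: 1) - c t))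
    snd _ _ _ dc).
  exact: cvg_snd.
by apply: DeriveDef; [apply/cvg_ex; exists ('D_1 c t).2|exact: cvg_lim H].
Qed.

Lemma derivable_curve_continuous : (forall t, derivable c t 1) -> continuous c.
Proof. by move=> dc t; apply/differentiable_continuous/derivable1_diffP. Qed.

Lemma continuous_curve1 : continuous c -> continuous (fun t => (c t).1).
Proof. by move=> cc t; apply: continuous_comp; [exact: cc|exact: cvg_fst]. Qed.

Lemma continuous_curve2 : continuous c -> continuous (fun t => (c t).2).
Proof. by move=> cc t; apply: continuous_comp; [exact: cc|exact: cvg_snd]. Qed.

End curve_components.

Section line.
Context {R : realType}.
Implicit Types (v : R * R) (t : R).

Lemma isD_line v t : is_derive t 1 (fun u : R => u *: v) v.
Proof.
have H : h^-1 *: ((h *: 1 + t) *: v - t *: v) @[h --> 0^'] --> v.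
  apply: cvg_near_cst; near=> h.
  rewrite -scalerBl addrK [h *: 1]mulr1 scalerA mulVf ?scale1r//.
  by near: h; exact: nbhs_dnbhs_neq.
by apply: DeriveDef; [apply/cvg_ex; exists v|exact: cvg_lim H].
Unshelve. all: by end_near. Qed.

Lemma derive1_line v : derive1 (fun u : R => u *: v) = cst v.
Proof. by apply/funext => t; have [_ E] := isD_line v t; rewrite derive1E E. Qed.

End line.

(** * Integration against a measure with a density *)

Section density.
Context d (T : measurableType d) (R : realType).
Variables (mu nu : {measure set T -> \bar R}) (k : T -> R).
Hypothesis k_ge0 : forall x, 0 <= k x.
Hypothesis mk : measurable_fun [set: T] k.
Hypothesis nuE : forall A, measurable A -> nu A = (\int[mu]_(x in A) (k x)%:E)%E.

Import HBNNSimple.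

(** On indicator functions this is [nuE]; simple functions follow by linearity, and monotone
    convergence on both sides gives the rest. *)
Lemma ge0_integral_density (f : T -> \bar R) : (forall x, (0 <= f x)%E) ->
  measurable_fun [set: T] f ->
  (\int[nu]_x f x = \int[mu]_x (f x * (k x)%:E))%E.
Proof.
move=> f0 mf; pose h := nnsfun_approx measurableT mf.
have mkE : measurable_fun [set: T] (EFin \o k) by exact/measurable_EFinP.
have mhE n : measurable_fun [set: T] (EFin \o h n).
  exact/measurable_EFinP/measurable_funP.
have -> : (\int[nu]_x f x = lim (\int[nu]_x (EFin \o h n) x @[n --> \oo]))%E.
  have fE x : f x = lim ((EFin \o h n) x @[n --> \oo]).
    by apply/esym/cvg_lim => //; exact: (cvg_nnsfun_approx measurableT mf).
  under eq_integral do rewrite fE.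
  apply: monotone_convergence => //.
  - by move=> n x _ /=; rewrite lee_fin.
  - by move=> x _ a b ab; rewrite lee_fin; exact/lefP/nd_nnsfun_approx.
have -> : (\int[mu]_x (f x * (k x)%:E) =
    lim (\int[mu]_x ((EFin \o h n) \* (EFin \o k)) x @[n --> \oo]))%E.
  have fk x : (f x * (k x)%:E =
      lim (((EFin \o h n) \* (EFin \o k)) x @[n --> \oo]))%E.
    by apply/esym/cvg_lim => //; apply: cvgeZr => //;
      exact: (cvg_nnsfun_approx measurableT mf).
  under eq_integral do rewrite fk.
  apply: monotone_convergence => //.
  - by move=> n; exact: emeasurable_funM.
  - by move=> n x _ /=; rewrite mule_ge0 ?lee_fin.
  - move=> x _ a b ab/=; rewrite lee_wpmul2r ?lee_fin//.
    exact/lefP/nd_nnsfun_approx.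
suff suf n : (\int[mu]_x ((EFin \o h n) x * (EFin \o k) x) =
    \int[nu]_x (EFin \o h n) x)%E.
  by under [in RHS]eq_fun do rewrite suf.
transitivity (\int[nu]_x
   (\sum_(y \in range (h n)) (y * \1_(h n @^-1` [set y]) x)%:E))%E; last first.
  by apply: eq_integral => t tE; rewrite /= fimfunE -fsumEFin.
have indich r : measurable_fun [set: T]
    (fun x => (r * \1_(h n @^-1` [set r]) x)%:E).
  by apply: (measurable_comp measurableT) => //; exact: measurable_funM.
rewrite ge0_integral_fsum//; last by move=> m y _; exact: nnfun_muleindic_ge0.
transitivity (\int[mu]_x (\sum_(y \in range (h n))
    (y * \1_(h n @^-1` [set y]) x)%:E * (k x)%:E))%E.
  under [RHS]eq_integral => x xE.
    rewrite -ge0_mule_fsuml => [|y]; last exact: nnfun_muleindic_ge0.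
    rewrite fsumEFin // -(fimfunE _ x); over.
  by [].
rewrite ge0_integral_fsum//; last 2 first.
  - by move=> y; exact: emeasurable_funM.
  - move=> m y _; apply: mule_ge0; last by rewrite lee_fin.
    by rewrite EFinM nnfun_muleindic_ge0.
apply: eq_fsbigr => r rhn.
under [RHS]eq_integral do rewrite EFinM.
rewrite integralZl_indic_nnsfun => //.
under eq_integral do rewrite EFinM -muleA.
rewrite ge0_integralZl//.
- under eq_integral do rewrite muleC.
  rewrite (eq_integral ((EFin \o k) \_ (h n @^-1` [set r]))); last first.
    by move=> x xE; rewrite epatch_indic.
  rewrite -integral_mkcondr setTI integral_indic// setIT.
  by rewrite nuE.
- by apply: emeasurable_funM => //; exact/measurable_EFinP.
- by move=> t _; rewrite mule_ge0 ?lee_fin.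
- by move: rhn; rewrite inE => -[t _ <-]; rewrite lee_fin.
Qed.

Lemma integrable_density (f : T -> R) : measurable_fun [set: T] f ->
  mu.-integrable setT (EFin \o (fun x => f x * k x)) ->
  nu.-integrable setT (EFin \o f).
Proof.
move=> mf /integrableP[_ fk]; apply/integrableP; split.
  exact/measurable_EFinP.
rewrite ge0_integral_density//; last first.
  by apply: measurableT_comp => //; exact/measurable_EFinP.
rewrite (eq_integral (fun x => `|(EFin \o (fun x => (f x * k x)%R)) x|)%E)//.
by move=> x _ /=; rewrite -EFinM normrM (ger0_norm (k_ge0 x)).
Qed.

Lemma Rintegral_density (f : T -> R) : measurable_fun [set: T] f ->
  \int[nu]_x f x = \int[mu]_x (f x * k x).
Proof.
move=> mf; have mfE : measurable_fun [set: T] (EFin \o f) by exact/measurable_EFinP.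
rewrite /Rintegral; congr fine.
rewrite [LHS]integralE [RHS]integralE.
rewrite (ge0_integral_density _ (measurable_funepos mfE))//.
rewrite (ge0_integral_density _ (measurable_funeneg mfE))//.
congr (_ - _)%E; apply: eq_integral => x _.
  by rewrite !funeposE/= -!EFin_max -EFinM maxr_pMl// mul0r.
by rewrite !funenegE/= -!EFin_max -EFinM maxr_pMl// mul0r mulNr.
Qed.

End density.

Lemma continuous_measurable_plane {R : realType} (F : R * R -> R) :
  continuous F ->
  measurable_fun [set: measurableTypeR R * measurableTypeR R] F.
Proof.
move=> cF; apply: (measurability _ (RGenOpens.measurableE R)).
move=> _ [_ [a [b ->] <-]]; rewrite setTI; apply: open_measurable_plane.
by apply: open_comp; [move=> p _; exact: cF|exact: interval_open].
Qed.

(** * Integrals of compactly supported functions on the plane *)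

Section plane_integrals.
Context {R : realType}.
Local Notation mu := (@lebesgue_measure R).
Local Notation mu2 := (mu \x mu)%E.
Implicit Types (F : R * R -> R) (N : R) (p : R * R).

Lemma prod_norm_le p N : (`|p| <= N) = (`|p.1| <= N) && (`|p.2| <= N).
Proof. by rewrite prod_normE ge_max. Qed.

Lemma integrable_compactly_supported F N : continuous F ->
  (forall p, N < `|p| -> F p = 0) -> mu2.-integrable setT (EFin \o F).
Proof.
move=> cF F0.
(* The norm of the product is the maximum norm, so its closed ball of radius [N] is a square, whose
   measure is a product of lengths. *)
pose B : set (measurableTypeR R * measurableTypeR R) :=
  `[- N, N]%classic `*` `[- N, N]%classic.
have BE p : B p <-> `|p| <= N.
  by rewrite prod_norm_le !ler_norml /B /= !in_itv/=; split=> [[-> ->]|/andP].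
have mB : measurable B by apply: measurableX; exact: measurable_itv.
have -> : EFin \o F = (EFin \o F) \_ B.
  apply/funext => p; rewrite patchE; case: ifPn => // /negP pB.
  rewrite /= F0// ltNge; apply/negP => pN; apply: pB.
  by rewrite inE; apply/BE.
apply/(iffLR (integrable_mkcond _ mB)).
apply: (measurable_bounded_integrable mB).
- have mI : measurable (`[- N, N]%classic : set (measurableTypeR R)).
    exact: measurable_itv.
  suff : (mu `[(- N)%R, N] * mu `[(- N)%R, N] < +oo)%E.
    by rewrite -(product_measure1E _ _ mI mI).
  apply: lte_mul_pinfty => //.
    by rewrite lebesgue_measure_itv/=; case: ifP => // _; rewrite -EFinD.
  by rewrite lebesgue_measure_itv/=; case: ifP => // _; rewrite -EFinD ltry.
- have mF := continuous_measurable_plane cF.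
    exact: (measurable_funTS mF).
- have cB : compact (B : set (R * R)).
    by apply: compact_setX; exact: segment_compact.
  have [M [_ HM]] := compact_bounded (continuous_compact
    (continuous_subspaceT cF) cB).
  exists M; split; first exact: num_real.
  by move=> x Mx p Bp; apply: HM => //; exists p.
Qed.

(** The strict inequality is an open condition, so [F] vanishes on a neighborhood of [p] and not
    only at [p]. *)
Lemma partial_supported F N i p : (forall p, N < `|p| -> F p = 0) ->
  N < `|p| -> partial i F p = 0.
Proof.
move=> F0 Np; rewrite /partial (@near_eq_derive _ _ _ F (cst 0)) ?derive_cst//.
near=> q; apply: F0; near: q.
by apply: cvgr_gt Np; exact: norm_continuous.
Unshelve. all: by end_near. Qed.

Lemma Rintegral_line (G G' : R -> R) N :
  (forall x : R, is_derive x 1 G (G' x)) -> continuous G' ->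
  (forall x, N < `|x| -> G x = 0 /\ G' x = 0) ->
  (\int[mu]_x (G' x)%:E = 0)%E.
Proof.
(* Both endpoints of [[- M, M]] have to lie strictly beyond [N], where [G] vanishes. *)
move=> dG cG' G0; pose M := `|N| + 1.
have M0 : 0 < M by rewrite ltr_wpDl.
have NM : N < M by rewrite ltr_pwDr// ler_norm.
have -> : (\int[mu]_x (G' x)%:E = \int[mu]_(x in `[(- M)%R, M]) (G' x)%:E)%E.
  rewrite [RHS]integral_mkcond; apply: eq_integral => x _.
  rewrite patchE; case: ifPn => // /negP xM; rewrite (G0 x _).2//.
  apply: lt_le_trans NM _; rewrite leNgt; apply/negP => /ltW xM'; apply: xM.
  by rewrite inE /= in_itv/= -ler_norml.
have MM : - M < M by rewrite gtrN.
have iG : mu.-integrable `[- M, M] (EFin \o G').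
  apply: continuous_compact_integrable; first exact: segment_compact.
  exact: continuous_subspaceT.
rewrite -[LHS]fineK; last exact: integrable_fin_num iG.
rewrite -/(Rintegral _ _ _) (Rintegral_derive MM dG cG').
have N1 : N < `|M| by rewrite gtr0_norm.
have N2 : N < `|- M| by rewrite normrN.
by rewrite (G0 _ N1).1 (G0 _ N2).1 subrr.
Qed.

Lemma continuous_pairl (y : R) : continuous (fun x : R => (x, y)).
Proof.
move=> x; apply: (@cvg_pair _ _ _ (nbhs x) (nbhs x) (nbhs y) _ _ _ id (cst y)).
  exact: cvg_id.
exact: cvg_cst.
Qed.

Lemma continuous_pairr (x : R) : continuous (fun y : R => (x, y)).
Proof.
move=> y; apply: (@cvg_pair _ _ _ (nbhs y) (nbhs x) (nbhs y) _ _ _ (cst x) id).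
  exact: cvg_cst.
exact: cvg_id.
Qed.

Lemma isD_horizontal F (x y d : R) : is_derive (x, y) (frame R ord0) F d ->
  is_derive x 1 (fun u => F (u, y)) d.
Proof.
move=> [dF <-]; rewrite /derivable /derive in dF *.
set g1 := fun h => h^-1 *: _ in dF *.
have E : g1 = fun h => h^-1 *: (((fun u => F (u, y)) \o shift x) (h *: 1) - F (x, y)).
  apply/funext => h; rewrite /g1 /=; congr (_ *: (F (_, _) - _)).
  by rewrite /= [_ *: _]mulr0 add0r.
by rewrite E in dF *; apply: DeriveDef.
Qed.

Lemma isD_vertical F (x y d : R) : is_derive (x, y) (frame R ord_max) F d ->
  is_derive y 1 (fun u => F (x, u)) d.
Proof.
move=> [dF <-]; rewrite /derivable /derive in dF *.
set g1 := fun h => h^-1 *: _ in dF *.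
have E : g1 = fun h => h^-1 *: (((fun u => F (x, u)) \o shift y) (h *: 1) - F (x, y)).
  apply/funext => h; rewrite /g1 /=; congr (_ *: (F (_, _) - _)).
  by rewrite /= [_ *: _]mulr0 add0r.
by rewrite E in dF *; apply: DeriveDef.
Qed.

Lemma Rintegral_partial F N i : Ck 1 F -> (forall p, N < `|p| -> F p = 0) ->
  \int[mu2]_p partial i F p = 0.
Proof.
move=> CF F0.
have cF : continuous F := Ck_continuous CF.
have cdF : continuous (partial i F) := Ck_continuous (Ck_partial i CF).
have dF0 p := partial_supported i F0 (p := p).
have iF : mu2.-integrable setT (EFin \o partial i F).
  exact: integrable_compactly_supported cdF dF0.
have F0' p : N < `|p.1| \/ N < `|p.2| -> F p = 0 /\ partial i F p = 0.
  move=> H; suff Np : N < `|p| by split; [exact: F0|exact: dF0].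
  by rewrite prod_normE lt_max; apply/orP.
have dF p : is_derive p (frame R i) F (partial i F p) by exact: Ck_derive CF.
(* Fubini, with the inner integral taken in the direction [i]: there it is a difference of two
   values of [F] outside its support. *)
rewrite /Rintegral; case: (ord2P i) => iE; subst i.
  rewrite -(integral21_prod_meas1 iF)/= integral0_eq// => y _.
  apply: (@Rintegral_line (fun x => F (x, y)) _ N).
  - by move=> x; exact: isD_horizontal (dF _).
  - move=> x; apply: (@continuous_comp _ _ _ (fun x => (x, y)) (partial ord0 F)).
      exact: continuous_pairl.
    exact: cdF.
  - by move=> x Nx; apply: F0'; left.
rewrite -(integral12_prod_meas1 iF)/= integral0_eq// => x _.
apply: (@Rintegral_line (fun y => F (x, y)) _ N).
- by move=> y; exact: isD_vertical (dF _).
- move=> y; apply: (@continuous_comp _ _ _ (fun y => (x, y)) (partial ord_max F)).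
    exact: continuous_pairr.
  exact: cdF.
- by move=> y Ny; apply: F0'; right.
Qed.

End plane_integrals.

Lemma test_function_supported {R : realType} (phi : R * R -> R) :
  test_function phi -> exists N, forall p, N < `|p| -> phi p = 0.
Proof.
move=> [_ /compact_bounded[M [_ HM]]]; exists (`|M| + 1) => p Np.
apply: contrapT => phip.
have M1 : M < `|M| + 1 by rewrite ltr_pwDr// ler_norm.
have cp : closure [set x | phi x != 0] p by apply: subset_closure; exact/eqP.
by have := HM _ M1 p cp; rewrite /= leNgt Np.
Qed.

(** * Rotationally symmetric metrics *)

Section radial_metric.
Context {R : realType}.
Variables f h h1 h2 : R -> R.
Hypothesis f_gt0 : forall s, 0 < f s.
Hypothesis fhE : forall s, 0 <= s -> 1 + s * h s = f s ^+ 2.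
Hypothesis dh : forall s : R, 0 <= s -> is_derive s 1 h (h1 s).
Hypothesis dh1 : forall s : R, 0 <= s -> is_derive s 1 h1 (h2 s).
Hypothesis h_smooth : smooth (fun p : R * R => h (sqnorm p)).
Implicit Types (p q v : R * R) (i j k : 'I_2).

(* The metric dr^2 + r^2 f(r^2)^2 dtheta^2 in normal Cartesian coordinates is
   I + h(|p|^2) n n^T, with n = [rot90 p] orthogonal to p. *)
Definition radial_mx p : 'M[R]_2 :=
  \matrix_(i, j) ((i == j)%:R + h (sqnorm p) * (rot90 i p * rot90 j p)).

Lemma fh_neq0 p : 1 + sqnorm p * h (sqnorm p) != 0.
Proof. by rewrite fhE ?sqnorm_ge0// expf_neq0// gt_eqF. Qed.

Lemma radial_mx_sym p i j : radial_mx p i j = radial_mx p j i.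
Proof. by rewrite !mxE eq_sym [rot90 i p * _]mulrC. Qed.

Lemma inner_radial_mx p v w : inner (radial_mx p) v w = v.1 * w.1 + v.2 * w.2 +
  h (sqnorm p) * ((p.2 * v.1 - p.1 * v.2) * (p.2 * w.1 - p.1 * w.2)).
Proof. by rewrite /inner !sum_ord2 !mxE /rot90 /coordinate /=; ring. Qed.

(* [|p|^2 g(v, v) = (p . v)^2 + f^2 (p x v)^2] *)
Lemma radial_mx_ge p v : (p.1 * v.1 + p.2 * v.2) ^+ 2 <=
  sqnorm p * inner (radial_mx p) v v.
Proof.
rewrite inner_radial_mx.
have -> : sqnorm p * (v.1 * v.1 + v.2 * v.2 + h (sqnorm p) *
    ((p.2 * v.1 - p.1 * v.2) * (p.2 * v.1 - p.1 * v.2))) =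
  (p.1 * v.1 + p.2 * v.2) ^+ 2 +
    (1 + sqnorm p * h (sqnorm p)) * (p.2 * v.1 - p.1 * v.2) ^+ 2.
  by rewrite /sqnorm; ring.
by rewrite fhE ?sqnorm_ge0// lerDl mulr_ge0// sqr_ge0.
Qed.

Lemma radial_mx_pos p v : v != 0 -> 0 < inner (radial_mx p) v v.
Proof.
move=> v0; rewrite inner_radial_mx.
have V0 : 0 < v.1 * v.1 + v.2 * v.2.
  rewrite lt_neqAle eq_sym (sqnorm_ge0 v) andbT; apply: contra v0.
  rewrite paddr_eq0 -?expr2 ?sqr_ge0// !sqrf_eq0 => /andP[/eqP a /eqP b].
  by apply/eqP; rewrite [v]surjective_pairing a b.
have := fhE (sqnorm_ge0 p); have := sqr_ge0 (p.1 * v.1 + p.2 * v.2).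
have : 0 < f (sqnorm p) ^+ 2 by rewrite exprn_gt0.
set F := f _ ^+ 2; set H := h _; rewrite /sqnorm => F0 pv FE.
have W0 : 0 <= (p.2 * v.1 - p.1 * v.2) ^+ 2 by exact: sqr_ge0.
have [H0|H0] := leP 0 H.
  by rewrite ltr_pwDl// mulr_ge0// -expr2.
(* For negative [H], Lagrange's identity gives [(p.2 * v.1 - p.1 * v.2) ^+ 2 <= sqnorm p * sqnorm
   v], so the form is at least [(1 + sqnorm p * H) * sqnorm v], whose first factor is [F]. *)
nra.
Qed.

Lemma radial_mx_smooth i j : smooth (fun p => radial_mx p i j).
Proof.
move=> k; rewrite (_ : (fun p => _) =
  fun p => (i == j)%:R + h (sqnorm p) * (rot90 i p * rot90 j p)).
  apply: CkD; first exact: Ck_cst.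
  by apply: CkM; [exact: h_smooth|apply: CkM; exact: Ck_rot].
by apply/funext => p; rewrite mxE.
Qed.

Definition radial_metric : riemannian_metric R :=
  RiemannianMetric radial_mx_sym radial_mx_pos radial_mx_smooth.
Let g := radial_metric.

Lemma det_radial p : \det (g p) = 1 + sqnorm p * h (sqnorm p).
Proof.
rewrite (expand_det_row _ ord0) sum_ord2 /cofactor !det_mx11 !mxE /= /rot90 /=.
by rewrite /sqnorm; ring.
Qed.

Lemma sqrt_det_radial p : sqrt_det g p = f (sqnorm p).
Proof. by rewrite /sqrt_det det_radial fhE ?sqnorm_ge0// sqrtr_sqr gtr0_norm. Qed.

(** The vector p and its rotation n are orthogonal eigenvectors of the metric, with eigenvalues 1
    and 1 + s h, where s = |p|^2, and p p^T + n n^T = s I. Hence inverting amounts to exchanging p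
    and n and dividing by the determinant. *)
Lemma inv_radial i j p : inv_metric g i j p =
  ((i == j)%:R + h (sqnorm p) * (coordinate i p * coordinate j p)) /
  (1 + sqnorm p * h (sqnorm p)).
Proof.
pose B : 'M[R]_2 := \matrix_(i, j)
  (((i == j)%:R + h (sqnorm p) * (coordinate i p * coordinate j p)) /
    (1 + sqnorm p * h (sqnorm p))).
have gB : g p *m B = 1%:M.
  apply/matrixP => k l; rewrite !mxE sum_ord2 !mxE.
  by case: (ord2P k) => ->; case: (ord2P l) => ->;
    rewrite /rot90 /coordinate /=; have := fh_neq0 p; rewrite /sqnorm => ?; field.
have [gu _] := mulmx1_unit gB.
rewrite /inv_metric; have -> : invmx (g p) = B.
  by rewrite -[LHS]mulmx1 -gB mulmxA mulVmx// mul1mx.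
by rewrite mxE.
Qed.

Lemma partial_radial_mx i j k p : partial i (fun q => g q j k) p =
  h1 (sqnorm p) * (2 * coordinate i p) * (rot90 j p * rot90 k p) +
  h (sqnorm p) * (rot90 j (frame R i) * rot90 k p + rot90 j p * rot90 k (frame R i)).
Proof.
apply: partial_val.
rewrite (_ : (fun p => _) =
    fun p => (j == k)%:R + h (sqnorm p) * (rot90 j p * rot90 k p)); last first.
  by apply/funext => q; rewrite mxE.
apply: isD_val.
  apply: isD_add.
  apply: isD_mul; first exact/isD_radial/dh/sqnorm_ge0.
  by apply: isD_mul; exact: isD_rot.
by case: (ord2P i) => ->; rewrite /coordinate /frame /=; ring.
Qed.

(** Apart from the inverse determinant, a polynomial in the coordinates, [h] and [h1]: the curvature
    proof can differentiate it by applying rules mechanically. *)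
Definition radial_christoffel k i j p : R :=
  (1 + sqnorm p * h (sqnorm p))^-1 *
  (h1 (sqnorm p) * ((coordinate i p * rot90 j p + coordinate j p * rot90 i p) * rot90 k p)
   + h (sqnorm p) * (rot90 j p * rot90 k (frame R i) + rot90 i p * rot90 k (frame R j))
   - 2 * (h (sqnorm p) * h (sqnorm p)) * (coordinate k p * (rot90 i p * rot90 j p)))
  - h1 (sqnorm p) * (coordinate k p * (rot90 i p * rot90 j p)).

Lemma christoffel_radial k i j : christoffel g k i j = radial_christoffel k i j.
Proof.
apply/funext => p.
rewrite /christoffel /radial_christoffel sum_ord2 !inv_radial !partial_radial_mx.
have := fh_neq0 p; rewrite /sqnorm => ?.
by case: (ord2P k) => ->; case: (ord2P i) => ->; case: (ord2P j) => ->;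
  rewrite /rot90 /coordinate /frame /=; field.
Qed.

Lemma gauss_curvature_radial p : let s := sqnorm p in
  let F := 1 + s * h s in
  let F1 := h s + s * h1 s in let F2 := 2 * h1 s + s * h2 s in
  gauss_curvature g p = - (3 * F1 * F + 2 * s * F2 * F - s * F1 ^+ 2) / F ^+ 2.
Proof.
pose dF v := 2 * (p.1 * v.1 + p.2 * v.2) * h (sqnorm p) +
  sqnorm p * (h1 (sqnorm p) * (2 * (p.1 * v.1 + p.2 * v.2))).
have isD_F v : is_derive p v (fun q => (1 + sqnorm q * h (sqnorm q))^-1)
    (- (0 + dF v) / (1 + sqnorm p * h (sqnorm p)) ^+ 2).
  apply: isD_inv; first exact: fh_neq0.
  apply: isD_add.
  apply: isD_mul; first exact: isD_sqnorm.
  exact/isD_radial/dh/sqnorm_ge0.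
have isD_h v := isD_radial v (dh (sqnorm_ge0 p)).
have isD_h1 v := isD_radial v (dh1 (sqnorm_ge0 p)).
rewrite /gauss_curvature /riemann_tensor det_radial !sum_ord2 !christoffel_radial !mxE.
(* [D0] and [D1] are holes, filled by the closing [reflexivity] with the expressions that the
   differentiation rules produce. *)
evar (D0 : 'I_2 -> R); evar (D1 : 'I_2 -> R).
have d0 k : partial ord0 (radial_christoffel k ord_max ord_max) p = D0 k.
  apply: partial_val; rewrite /radial_christoffel.
  apply: isD_val.
    by repeat first [exact: isD_F|exact: isD_h|exact: isD_h1|exact: isD_rot|exact: isD_coordinate
     |exact: isD_cst|apply: isD_mul|apply: isD_add|apply: isD_opp].
  rewrite /D0; reflexivity.
have d1 k : partial ord_max (radial_christoffel k ord0 ord_max) p = D1 k.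
  apply: partial_val; rewrite /radial_christoffel.
  apply: isD_val.
    by repeat first [exact: isD_F|exact: isD_h|exact: isD_h1|exact: isD_rot|exact: isD_coordinate
     |exact: isD_cst|apply: isD_mul|apply: isD_add|apply: isD_opp].
  rewrite /D1; reflexivity.
rewrite !d0 !d1 /D0 /D1 /dF /radial_christoffel /rot90 /coordinate /frame.
rewrite /GRing.scale /=.
have := fh_neq0 p; rewrite /sqnorm => ?.
by field.
Qed.

(** Straight lines through 0 are geodesics: in [radial_christoffel] at [t *: v], contracted twice
    with [v], every term contains the pairing of the rotated vector with [v], which is 0. So the
    exponential map at 0 is the identity of the chart. *)
Lemma radial_pole : is_pole g 0.
Proof.
exists id; last first.
  split; first by move=> k; exact: Ck_id.
  by exists id; split => // k; exact: Ck_id.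
move=> v; exists (fun t : R => t *: v); split.
- move=> t; rewrite derive1_line.
  have [dl _] := isD_line v t.
  split; [exact: dl|exact: derivable_cst|move=> k].
  rewrite derive1_cst !sum_ord2 !christoffel_radial.
  rewrite /radial_christoffel /rot90 /coordinate /=.
  by rewrite /GRing.scale /=; case: (ord2P k) => -> /=; ring.
- by rewrite scale0r.
- by rewrite derive1_line.
- by rewrite scale1r.
Qed.

(** * Distance from the pole *)

Lemma speed_continuous (c : R -> R * R) :
  continuous c -> continuous (derive1 c) ->
  continuous (fun t => Num.sqrt (inner (g (c t)) (derive1 c t) (derive1 c t))).
Proof.
move=> cc cc' t; apply: continuous_comp; last exact: sqrt_continuous.
pose n u := (c u).2 * (derive1 c u).1 - (c u).1 * (derive1 c u).2.
rewrite (_ : (fun _ => _) = fun u => (derive1 c u).1 * (derive1 c u).1 +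
  (derive1 c u).2 * (derive1 c u).2 + h (sqnorm (c u)) * (n u * n u)); last first.
  by apply/funext => u; rewrite inner_radial_mx.
have cn : {for t, continuous n}.
  by apply: cvgB; apply: cvgM;
    by [exact: continuous_curve1|exact: continuous_curve2].
apply: cvgD.
  by apply: cvgD; apply: cvgM;
    by [exact: continuous_curve1|exact: continuous_curve2].
apply: cvgM; last exact: cvgM.
apply: (@continuous_comp _ _ _ c (fun p => h (sqnorm p))); first exact: cc.
exact: (h_smooth 0).
Qed.

(* Since |c| need not be differentiable where c passes through the pole, |c| is
   replaced by sqrt (d + |c|^2), and d tends to 0 at the end. *)
Lemma curve_length_ge (c : R -> R * R) (d : R) : 0 < d ->
  (forall t, derivable c t 1) -> continuous (derive1 c) ->
  Num.sqrt (d + sqnorm (c 1)) - Num.sqrt (d + sqnorm (c 0)) <= curve_length g c.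
Proof.
move=> d0 dc cc'.
have cc := derivable_curve_continuous dc.
pose r t := Num.sqrt (d + sqnorm (c t)).
pose w t := (c t).1 * (derive1 c t).1 + (c t).2 * (derive1 c t).2.
have dn0 t : 0 < d + sqnorm (c t) by rewrite ltr_pwDl// sqnorm_ge0.
have r0 t : 0 < r t by rewrite sqrtr_gt0.
have dr (t : R) : is_derive t 1 r (w t / r t).
  have c1 := isD_curve1 (dc t); have c2 := isD_curve2 (dc t).
  have ds := isD_add (isD_cst t 1 d) (isD_add (isD_mul c1 c1) (isD_mul c2 c2)).
  apply: (isD_val (@isD_comp _ _ (fun u => d + sqnorm (c u)) _ _ _ _ _
    (is_derive1_sqrt (dn0 t)) ds)).
  rewrite -/(r t) /w.
  by have := r0 t; rewrite lt0r => /andP[? _]; field.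
have cw : continuous (fun t => w t / r t).
  move=> t; apply: cvgM; last first.
    apply: cvgV; first by rewrite gt_eqF.
    by apply/differentiable_continuous/derivable1_diffP; have [] := dr t.
  by apply: cvgD; apply: cvgM;
    by [exact: continuous_curve1|exact: continuous_curve2].
rewrite -(Rintegral_derive ltr01 dr cw) /curve_length.
apply: le_Rintegral => //.
- apply: continuous_compact_integrable; first exact: segment_compact.
  exact: continuous_subspaceT.
- apply: continuous_compact_integrable; first exact: segment_compact.
  exact/continuous_subspaceT/speed_continuous.
move=> t _; rewrite ler_pdivrMr// mulrC.
apply: le_trans (ler_norm _) _.
rewrite -sqrtr_sqr /r -(sqrtrM _ (ltW (dn0 t))); apply: ler_wsqrtr.
apply: le_trans (radial_mx_ge _ _) _.
apply: ler_wpM2r; last by rewrite lerDr ltW.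
have [->|v0] := eqVneq (derive1 c t) 0.
  by rewrite inner_radial_mx/= !mulr0 subr0 !mulr0 !addr0.
by rewrite ltW// radial_mx_pos.
Qed.

Lemma piecewise_length_ge p q (s : seq (R -> R * R)) (d : R) : 0 < d ->
  piecewise_C1_curve p q s ->
  Num.sqrt (d + sqnorm q) - Num.sqrt (d + sqnorm p) <=
    \sum_(c <- s) curve_length g c.
Proof.
move=> d0; elim: s p => [|c s IH] p /=; first by move=> ->; rewrite big_nil subrr.
move=> [dc cc' <- /IH Hs]; rewrite big_cons.
have := lerD (curve_length_ge d0 dc cc') Hs.
by rewrite addrC addrA subrK.
Qed.

Lemma radial_distance p : riemannian_distance g 0 p = Num.sqrt (sqnorm p).
Proof.
have sq0 : sqnorm (0 : R * R) = 0 by rewrite /sqnorm /= mulr0 addr0.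
pose E := [set L | exists2 s : seq (R -> R * R),
  piecewise_C1_curve 0 p s & L = \sum_(c <- s) curve_length g c].
have lbE : lbound E (Num.sqrt (sqnorm p)).
  move=> L [s ps ->]; apply/ler_addgt0Pr => e e0.
  (* With [d = e ^+ 2] the term at the starting point 0 is exactly [e]. *)
  have := piecewise_length_ge (exprn_gt0 2 e0) ps.
  rewrite sq0 addr0 sqrtr_sqr gtr0_norm// lerBlDr; apply: le_trans.
  by apply: ler_wsqrtr; rewrite lerDr sqr_ge0.
have Ep : E (Num.sqrt (sqnorm p)).
  exists [:: fun t : R => t *: p].
    rewrite /= derive1_line scale0r scale1r; split => //.
      by move=> t; have [] := isD_line p t.
    by move=> t; exact: cvg_cst.
  rewrite big_seq1 /curve_length derive1_line.
  rewrite (_ : (fun _ => _) = fun=> Num.sqrt (sqnorm p)).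
    rewrite Rintegral_cst//.
    have := @lebesgue_measure_itv R `[0%R,1%R]; rewrite /= lte_fin ltr01 => ->.
    by rewrite oppr0 addr0 mulr1.
  apply/funext => t; rewrite inner_radial_mx /sqnorm /=; congr Num.sqrt.
  by rewrite /GRing.scale/=; ring.
apply/eqP; rewrite eq_le; apply/andP; split.
  by apply: ge_inf => //; exists (Num.sqrt (sqnorm p)).
by apply: lb_le_inf => //; exists (Num.sqrt (sqnorm p)).
Qed.

(** * Integration over the surface and Green's identity *)

Local Notation mu2 := (@lebesgue_measure R \x @lebesgue_measure R)%E.

Lemma Rintegral_radial (F : R * R -> R) : continuous F ->
  \int[riemannian_measure g]_p F p =
  \int[mu2]_p (F p * f (sqnorm p)).
Proof.
move=> cF; rewrite (@Rintegral_density _ _ _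
  mu2 (riemannian_measure g) (sqrt_det g)).
- by apply: eq_Rintegral => p _; rewrite sqrt_det_radial.
- by move=> p; exact: sqrtr_ge0.
- exact: measurable_sqrt_det.
- by [].
- exact: continuous_measurable_plane.
Qed.

Hypothesis f_smooth : smooth (fun p : R * R => f (sqnorm p)).
Hypothesis fV_smooth : smooth (fun p : R * R => (f (sqnorm p))^-1).

Lemma inv_radial_smooth i j : smooth (inv_metric g i j).
Proof.
move=> n; rewrite (_ : inv_metric g i j = fun p =>
    ((i == j)%:R + h (sqnorm p) * (coordinate i p * coordinate j p)) *
    ((f (sqnorm p))^-1 * (f (sqnorm p))^-1)).
  apply: CkM; last by apply: CkM; exact: fV_smooth.
  apply: CkD; first exact: Ck_cst.
  by apply: CkM; [exact: h_smooth|apply: CkM; exact: Ck_coordinate].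
by apply/funext => p; rewrite inv_radial// fhE ?sqnorm_ge0// expr2 invfM.
Qed.

(* The Laplacian of W(|p|^2) is 4 (s V(s))' / f(s) at s = |p|^2, and
   f (w Delta phi - phi Delta w) is the divergence of [Psi phi]. *)
Section supersolution.
Variables W W1 V1 : R -> R.
Variable M : R.
Let V s := f s * W1 s.
Hypothesis dW : forall s : R, 0 <= s -> is_derive s 1 W (W1 s).
Hypothesis dV : forall s : R, 0 <= s -> is_derive s 1 V (V1 s).
Hypothesis W_smooth : smooth (fun p : R * R => W (sqnorm p)).
Hypothesis V_smooth : smooth (fun p : R * R => V (sqnorm p)).
Hypothesis V1_continuous : continuous (fun p : R * R => V1 (sqnorm p)).
Hypothesis W_subsolution :
  forall s, 0 <= s -> f s * (W s - M) <= 4 * (V s + s * V1 s).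

Let w p := W (sqnorm p) - M.
Let flux phi i p := f (sqnorm p) * coordinate i (gradient g phi p).
Let Psi phi i p := w p * flux phi i p - phi p * (2 * coordinate i p * V (sqnorm p)).

Lemma Ck_flux n phi i : smooth phi -> Ck n (flux phi i).
Proof.
move=> sphi; apply: CkM; first exact: f_smooth.
rewrite (_ : (fun p => _) = fun p =>
    inv_metric g i ord0 p * partial ord0 phi p +
    inv_metric g i ord_max p * partial ord_max phi p).
  by apply: CkD; apply: CkM; (exact: inv_radial_smooth || exact/Ck_partial/sphi).
by apply/funext => p; case: (ord2P i) => ->;
  rewrite /gradient /coordinate /vec_of/= sum_ord2.
Qed.

Lemma Ck_Psi n phi i : smooth phi -> Ck n (Psi phi i).
Proof.
move=> sphi; apply: CkD.
  apply: CkM; last exact: Ck_flux.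
  by apply: CkD; [exact: W_smooth|exact: Ck_cst].
apply/CkN/CkM; first exact: sphi.
apply: CkM; last exact: V_smooth.
by apply: CkM; [exact: Ck_cst|exact: Ck_coordinate].
Qed.

Lemma laplace_beltrami_radial phi p : f (sqnorm p) * laplace_beltrami g phi p =
  partial ord0 (flux phi ord0) p + partial ord_max (flux phi ord_max) p.
Proof.
rewrite /laplace_beltrami /divergence sqrt_det_radial sum_ord2 mulrA.
rewrite divff ?gt_eqF// mul1r /flux.
by congr (partial _ _ _ + partial _ _ _); apply/funext => q; rewrite sqrt_det_radial.
Qed.

Lemma Green_identity phi p : smooth phi ->
  f (sqnorm p) * (- w p * (- laplace_beltrami g phi p + phi p)) =
  partial ord0 (Psi phi ord0) p + partial ord_max (Psi phi ord_max) p +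
  phi p * (4 * (V (sqnorm p) + sqnorm p * V1 (sqnorm p)) - f (sqnorm p) * w p).
Proof.
move=> sphi; have s0 := sqnorm_ge0 p.
have dPsi i : partial i (Psi phi i) p =
  (W1 (sqnorm p) * (2 * coordinate i p) * flux phi i p +
  w p * partial i (flux phi i) p) -
  (partial i phi p * (2 * coordinate i p * V (sqnorm p)) +
   phi p * (2 * V (sqnorm p) + 2 * coordinate i p * (V1 (sqnorm p) * (2 * coordinate i p)))).
  apply: partial_val; apply: isD_val.
    apply: isD_add.
      apply: isD_mul; last exact: (Ck_derive i p (Ck_flux 1 i sphi)).
      by apply: isD_add; exact/isD_radial/dW.
    apply/isD_opp/isD_mul; first exact: (Ck_derive i p (sphi 1)).
    apply: isD_mul; last exact/isD_radial/dV.
    by apply: isD_mul; exact: isD_coordinate.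
  by case: (ord2P i) => ->; rewrite /coordinate /frame /=; ring.
rewrite mulrCA mulrDr mulrN laplace_beltrami_radial !dPsi.
(* The inverse metric fixes the vector p, so pairing [flux] with p leaves the Euclidean radial
   derivative of [phi] times f. As [V] is [f * W1], the products of first derivatives in the
   divergence of [Psi] then cancel. *)
have fX : coordinate ord0 p * flux phi ord0 p + coordinate ord_max p * flux phi ord_max p =
    f (sqnorm p) * (coordinate ord0 p * partial ord0 phi p +
    coordinate ord_max p * partial ord_max phi p).
  rewrite /flux /gradient /vec_of /coordinate /= !sum_ord2 !inv_radial /coordinate /=.
  by have := fh_neq0 p; rewrite /sqnorm => ?; field.
move: fX; rewrite /V; move: (flux phi ord0 p) (flux phi ord_max p) => F0 F1.
rewrite /coordinate /= => fX.
have sE : sqnorm p = p.1 * p.1 + p.2 * p.2 by [].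
move: (f (sqnorm p)) (W1 (sqnorm p)) (V1 (sqnorm p)) fX sE (w p) => fs Ws Vs fX sE ws.
move: (partial ord0 (flux phi ord0) p) (partial ord_max (flux phi ord_max) p) => dF0 dF1.
rewrite sE.
transitivity (ws * (dF0 + dF1) - ws * fs * phi p +
  2 * Ws * (p.1 * F0 + p.2 * F1 -
    fs * (p.1 * partial ord0 phi p + p.2 * partial ord_max phi p))).
  by rewrite fX subrr; ring.
by ring.
Qed.

(** The factor f of the Riemannian measure is the one in [Green_identity]. The divergence integrates
    to 0 because [Psi] is supported where [phi] is, and what remains is nonnegative by
    [W_subsolution]. *)
Lemma radial_supersolution :
  distributional_supersolution g (fun p => M - W (sqnorm p)).
Proof.
move=> phi tphi phi0; have sphi := tphi.1.
have [N phiN] := test_function_supported tphi.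
have cL : continuous (laplace_beltrami g phi).
  rewrite (_ : laplace_beltrami g phi = fun p => (f (sqnorm p))^-1 *
    (partial ord0 (flux phi ord0) p + partial ord_max (flux phi ord_max) p)).
    apply: (@Ck_continuous _ _ 0); apply: CkM; first exact: fV_smooth.
    by apply: CkD; exact/Ck_partial/Ck_flux.
  apply/funext => p; rewrite -laplace_beltrami_radial mulKf//.
  by rewrite gt_eqF.
have cphi := Ck_continuous (sphi 0).
have cw : continuous (fun p => M - W (sqnorm p)).
  move=> p; apply: cvgB; first exact: cvg_cst.
  exact: (Ck_continuous (W_smooth 0)).
rewrite Rintegral_radial; last first.
  move=> p; apply: cvgM; first exact: cw.
  by apply: cvgD; [apply: cvgN; exact: cL|exact: cphi].
pose Q p := phi p *
  (4 * (V (sqnorm p) + sqnorm p * V1 (sqnorm p)) - f (sqnorm p) * w p).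
pose D i := partial i (Psi phi i).
have -> : \int[mu2]_p
    ((M - W (sqnorm p)) * (- laplace_beltrami g phi p + phi p) * f (sqnorm p)) =
    \int[mu2]_p (D ord0 p + D ord_max p + Q p).
  apply: eq_Rintegral => p _.
  by rewrite -[RHS]Green_identity// mulrC /w opprB.
have Psi0 i p : N < `|p| -> Psi phi i p = 0.
  move=> Np; rewrite /Psi /flux /gradient /vec_of /coordinate/= !sum_ord2.
  rewrite !(partial_supported _ phiN Np) phiN// !mulr0 addr0.
  by case: ifP; rewrite !mulr0 mul0r subrr.
have cD i : continuous (D i).
  exact: (Ck_continuous (Ck_partial i (Ck_Psi 1 i sphi))).
have iD i : mu2.-integrable setT (EFin \o D i).
  by apply: (integrable_compactly_supported (N := N) (cD i)) => p Np;
    exact: partial_supported (Psi0 i) Np.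
have iQ : mu2.-integrable setT (EFin \o Q).
  apply: (@integrable_compactly_supported _ _ N); last by move=> p Np; rewrite /Q phiN// mul0r.
  move=> p; apply: cvgM; first exact: cphi.
  apply: cvgB.
    apply: cvgM; first exact: cvg_cst.
    apply: cvgD; first exact: (Ck_continuous (V_smooth 0)).
    by apply: cvgM; [exact: (Ck_continuous (Ck_sqnorm 0))|exact: V1_continuous].
  apply: cvgM; first exact: (Ck_continuous (f_smooth 0)).
  by apply: cvgB; [exact: (Ck_continuous (W_smooth 0))|exact: cvg_cst].
have iDD : mu2.-integrable setT
    (EFin \o (fun p => D ord0 p + D ord_max p)).
  exact: (integrableD measurableT (iD ord0) (iD ord_max)).
have D0 i : \int[mu2]_p D i p = 0.
  exact: Rintegral_partial (Ck_Psi 1 i sphi) (Psi0 i).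
rewrite RintegralD// RintegralD// !D0 !add0r; apply: Rintegral_ge0 => p _; rewrite mulr_ge0// subr_ge0.
exact/W_subsolution/sqnorm_ge0.
Qed.

End supersolution.

End radial_metric.

(** * The metric *)

Section powR_extra.
Context {R : realType}.
Implicit Types (x r s : R).

Lemma gt0_powRD x r s : 0 < x -> x `^ (r + s) = x `^ r * x `^ s.
Proof. by move=> x0; rewrite powRD//; apply/implyP => _; rewrite gt_eqF. Qed.

Lemma powR_ge1 x r : 0 <= r -> 1 <= x -> 1 <= x `^ r.
Proof.
move=> r0 x1; have : 1 `^ r <= x `^ r.
  by apply: ge0_ler_powR; rewrite ?nnegrE// (le_trans _ x1).
by rewrite powR1.
Qed.

End powR_extra.

Section shifted_power.
Context {R : realType}.
Implicit Types (r s : R).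

(** The n-th derivative of (1 + s)^r, as a sequence in [n] of the kind that [Ck_comp] and [hadamard]
    take. *)
Definition shifted_power r n s : R :=
  (\prod_(k < n) (r - k%:R)) * (1 + s) `^ (r - n%:R).

Lemma isD_shifted_power r n s : -1 < s ->
  is_derive s 1 (shifted_power r n) (shifted_power r n.+1 s).
Proof.
move=> s1; have t0 : 0 < 1 + s by rewrite -ltrBlDl sub0r.
have d1 := isD_add (isD_cst s 1 1) (is_derive_id s 1).
have := isD_mul (isD_cst s 1 (\prod_(k < n) (r - k%:R)))
  (@isD_comp _ _ (fun u : R => 1 + u) _ _ _ _ _ (is_derive1_powR (r - n%:R) t0) d1).
move=> /isD_val; apply.
rewrite /shifted_power big_ord_recr/= mul0r !add0r mulr1 mulrA; congr (_ * _ `^ _).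
by rewrite -natr1 opprD addrA.
Qed.

Lemma shifted_power0 r s : shifted_power r 0 s = (1 + s) `^ r.
Proof. by rewrite /shifted_power big_ord0 mul1r subr0. Qed.

Lemma shifted_power1 r s : shifted_power r 1 s = r * (1 + s) `^ (r - 1).
Proof. by rewrite /shifted_power big_ord1 subr0. Qed.

Lemma powR_smooth r : smooth (fun p : R * R => (1 + sqnorm p) `^ r).
Proof.
move=> k; rewrite (_ : (fun p => _) = fun p => shifted_power r 0 (sqnorm p)).
  apply: (Ck_comp (D := [set s : R | -1 < s])) => [n s /= s1| p /=|].
  - exact: isD_shifted_power.
  - by rewrite (lt_le_trans _ (sqnorm_ge0 p))// ltrN10.
  - exact: Ck_sqnorm.
by apply/funext => p; rewrite shifted_power0.
Qed.

Lemma expR_smooth (F : R * R -> R) : smooth F -> smooth (fun p => expR (F p)).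
Proof.
by move=> sF k; apply: (@Ck_comp _ _ (fun _ => expR) setT).
Qed.

(** Likewise, the n-th derivative of exp(-s). *)
Definition exp_opp n s : R := (-1) ^+ n * expR (- s).

Lemma isD_exp_opp n s : is_derive s 1 (exp_opp n) (exp_opp n.+1 s).
Proof.
have dN := isD_opp (is_derive_id s 1).
have := isD_mul (isD_cst s 1 ((-1) ^+ n))
  (@isD_comp _ _ (fun u : R => - u) _ _ _ _ _ (is_derive_expR (- s)) dN).
by move=> /isD_val; apply; rewrite /exp_opp exprS; ring.
Qed.

End shifted_power.

Section profile.
Context {R : realType}.
Variable a : R.
Hypothesis a_gt0 : 0 < a.
Implicit Types (s : R) (p : R * R).

Let beta := 1 + a.
Let A s := (1 + s) `^ beta - 1.
Let A1 s := beta * (1 + s) `^ a.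

Let gtN1 s : 0 <= s -> -1 < s.
Proof. by move=> s0; rewrite (lt_le_trans _ s0)// ltrN10. Qed.

Lemma isD_A s : -1 < s -> is_derive s 1 A (A1 s).
Proof.
move=> s1; have := isD_add (isD_shifted_power beta 0 s1) (isD_cst s 1 (-1)).
rewrite (_ : (fun y => _) = A); last by apply/funext => y; rewrite shifted_power0.
move=> /isD_val; apply; rewrite addr0 shifted_power1; congr (_ * _ `^ _).
by rewrite /beta addrAC subrr add0r.
Qed.

Lemma isD_A1 s : -1 < s -> is_derive s 1 A1 (beta * a * (1 + s) `^ (a - 1)).
Proof.
move=> s1; have := isD_mul (isD_cst s 1 beta) (isD_shifted_power a 0 s1).
rewrite (_ : (fun y => _) = A1); last by apply/funext => y; rewrite shifted_power0.
by move=> /isD_val; apply; rewrite mul0r add0r shifted_power1 mulrA.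
Qed.

Lemma A_ge0 s : 0 <= s -> 0 <= A s.
Proof.
by move=> s0; rewrite subr_ge0 powR_ge1 ?lerDl// addr_ge0// ltW.
Qed.

Definition profile s : R := expR (- A s).

Lemma profile_gt0 s : 0 < profile s. Proof. exact: expR_gt0. Qed.

Lemma profile_smooth : smooth (fun p => profile (sqnorm p)).
Proof.
apply: expR_smooth => k; apply/CkN/CkD; first exact: powR_smooth.
exact: Ck_cst.
Qed.

Lemma profileV_smooth : smooth (fun p => (profile (sqnorm p))^-1).
Proof.
rewrite (_ : (fun p => _) = fun p => expR (A (sqnorm p))).
  apply: expR_smooth => k; apply: CkD; first exact: powR_smooth.
  exact: Ck_cst.
by apply/funext => p; rewrite /profile (expRN) invrK.
Qed.

Let m n := hadamard (@shifted_power R beta) n.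
Let e n := hadamard (@exp_opp R) n.

(* [(expR (- 2 * A s) - 1) / s], as the product of [2 * A s / s] and of
   [(expR (- x) - 1) / x] at [x = 2 * A s], both smooth at [0]. *)
Definition metric_coef s : R := 2 * (m 0 s * e 0 (2 * A s)).

Let dm n s : 0 <= s -> is_derive s 1 (m n) (m n.+1 s).
Proof.
move=> /gtN1 s1; apply: isD_hadamard => //.
by move=> k x x1; exact: isD_shifted_power.
Qed.

Let de n s : 0 <= s -> is_derive s 1 (fun s => e n (2 * A s))
  (e n.+1 (2 * A s) * (2 * A1 s)).
Proof.
move=> s0; apply: (@isD_comp _ _ (fun s => 2 * A s)).
  apply: isD_hadamard; last by apply: gtN1; rewrite mulr_ge0// A_ge0.
  by move=> k x _; exact: isD_exp_opp.
apply: (isD_val (isD_mul (isD_cst s 1 2) (isD_A (gtN1 s0)))).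
by rewrite mul0r add0r.
Qed.

Lemma metric_coefE s : 0 <= s -> 1 + s * metric_coef s = profile s ^+ 2.
Proof.
move=> s0; have s1 := gtN1 s0.
have Hm : s * m 0 s = A s.
  rewrite /m (hadamard_factor (fun k x => @isD_shifted_power R beta k x) s1).
  by rewrite !shifted_power0 addr0 powR1.
have He : 2 * A s * e 0 (2 * A s) = expR (- (2 * A s)) - 1.
  have A2 : -1 < 2 * A s by apply: gtN1; rewrite mulr_ge0// A_ge0.
  rewrite /e (hadamard_factor (fun k x _ => @isD_exp_opp R k x) A2).
  by rewrite /exp_opp expr0 !mul1r oppr0 expR0.
rewrite /metric_coef.
have -> : s * (2 * (m 0 s * e 0 (2 * A s))) = 2 * (s * m 0 s) * e 0 (2 * A s) by ring.
rewrite Hm He /profile expr2 -expRD.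
have -> : - A s + - A s = - (2 * A s) by ring.
by ring.
Qed.

Definition metric_coef1 s : R :=
  2 * (m 1 s * e 0 (2 * A s) + m 0 s * (e 1 (2 * A s) * (2 * A1 s))).

Lemma isD_metric_coef s : 0 <= s -> is_derive s 1 metric_coef (metric_coef1 s).
Proof.
move=> s0; apply: (isD_val (isD_mul (isD_cst s 1 2) (isD_mul (dm 0 s0) (de 0 s0)))).
by rewrite mul0r add0r.
Qed.

(** Only existence is at stake: the curvature formula sees this derivative through the combination
    that [metric_coef_derive2] computes. *)
Lemma isD_metric_coef1 s : 0 <= s ->
  is_derive s 1 metric_coef1 (derive1 metric_coef1 s).
Proof.
move=> s0; rewrite derive1E; apply: derivableP.
have dA1 := isD_mul (isD_cst s 1 2) (isD_A1 (gtN1 s0)).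
by have [] := isD_mul (isD_cst s 1 2) (isD_add (isD_mul (dm 1 s0) (de 0 s0))
  (isD_mul (dm 0 s0) (isD_mul (de 1 s0) dA1))).
Qed.

Lemma metric_coef_smooth : smooth (fun p => metric_coef (sqnorm p)).
Proof.
move=> k; apply: CkM; first exact: Ck_cst.
apply: CkM.
  apply: (Ck_comp (D := [set s : R | -1 < s])) => [n s /= s1| p /=|].
  - by apply: isD_hadamard => // j x x1; exact: isD_shifted_power.
  - exact/gtN1/sqnorm_ge0.
  - exact: Ck_sqnorm.
apply: (@Ck_comp _ _ e [set s : R | -1 < s] (fun p => 2 * A (sqnorm p)))
  => [n s /= s1| p /=|].
- by apply: isD_hadamard => // j x x1; exact: isD_exp_opp.
- by apply: gtN1; rewrite mulr_ge0// A_ge0// sqnorm_ge0.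
- apply: CkM; first exact: Ck_cst.
  by apply: CkD; [exact: powR_smooth|exact: Ck_cst].
Qed.

Lemma isD_profile s : -1 < s -> is_derive s 1 profile (- A1 s * profile s).
Proof.
move=> s1; have := @isD_comp _ _ (fun s => - A s) _ _ _ _ _
  (is_derive_expR (- A s)) (isD_opp (isD_A s1)).
by move=> /isD_val; apply; rewrite mulrC.
Qed.

Let near_gt0 s : 0 < s -> \forall x \near s, 0 < x.
Proof. by move=> s0; exact: lt_nbhsr. Qed.

(** Obtained by differentiating [metric_coefE]. That identity is available for [0 <= s], so
    two-sided derivatives can be compared at interior points only; this suffices, the curvature
    being needed far from the pole. *)
Lemma metric_coef_derive s : 0 < s ->
  metric_coef s + s * metric_coef1 s = - 2 * A1 s * profile s ^+ 2.
Proof.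
move=> s0.
have d1 := isD_add (isD_cst s 1 1) (isD_mul (is_derive_id s 1) (isD_metric_coef (ltW s0))).
have df := isD_profile (gtN1 (ltW s0)).
have d2 := isD_mul df df.
have d3 : is_derive s 1 (fun s => 1 + s * metric_coef s)
    (- A1 s * profile s * profile s + profile s * (- A1 s * profile s)).
  apply: near_eq_is_derive d2.
  near=> x; rewrite -expr2 metric_coefE// ltW//; near: x; exact: near_gt0.
have [_ E1] := d1; have [_ E2] := d3; move: E1; rewrite E2 add0r => E.
by rewrite -[metric_coef s]mul1r -E; ring.
Unshelve. all: by end_near. Qed.

Lemma metric_coef_derive2 s : 0 < s ->
  2 * metric_coef1 s + s * derive1 metric_coef1 s =
  (4 * A1 s ^+ 2 - 2 * (beta * a * (1 + s) `^ (a - 1))) * profile s ^+ 2.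
Proof.
move=> s0.
have d1 := isD_add (isD_metric_coef (ltW s0))
  (isD_mul (is_derive_id s 1) (isD_metric_coef1 (ltW s0))).
have df := isD_profile (gtN1 (ltW s0)).
have d2 := isD_mul (isD_mul (isD_cst s 1 (- 2)) (isD_A1 (gtN1 (ltW s0))))
  (isD_mul df df).
have E : \forall x \near s, - 2 * A1 x * (profile x * profile x) =
    metric_coef x + x * metric_coef1 x.
  near=> x; rewrite -expr2 metric_coef_derive//; near: x; exact: near_gt0.
have [_ E1] := d1; have [_ E2] := near_eq_is_derive E d2.
move: E1; rewrite E2 => {}E.
transitivity (metric_coef1 s + (1 * metric_coef1 s + s * derive1 metric_coef1 s)).
  by ring.
by rewrite -E; ring.
Unshelve. all: by end_near. Qed.

Definition profile_metric : riemannian_metric R :=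
  radial_metric profile_gt0 metric_coefE metric_coef_smooth.

Lemma gauss_curvature_profile p : 0 < sqnorm p ->
  gauss_curvature profile_metric p =
  6 * A1 (sqnorm p) - 4 * sqnorm p * A1 (sqnorm p) ^+ 2
  + 4 * sqnorm p * (beta * a * (1 + sqnorm p) `^ (a - 1)).
Proof.
move=> s0; rewrite (gauss_curvature_radial _ _ isD_metric_coef isD_metric_coef1).
rewrite metric_coefE ?sqnorm_ge0// metric_coef_derive// metric_coef_derive2//.
by have := profile_gt0 (sqnorm p); rewrite lt0r => /andP[? _]; field.
Qed.

(** * The subsolution *)

(** Factoring 1 + s = (1 + s^-1) s isolates powers of a quantity tending to 1. The square comes from
    [- 4 * s * A1 s ^+ 2]; the other two terms are smaller by a factor of order s^(-1 - a). *)
Lemma curvature_ratio s : 0 < s ->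
  (6 * A1 s - 4 * s * A1 s ^+ 2 + 4 * s * (beta * a * (1 + s) `^ (a - 1))) /
    (- (4 * beta ^+ 2) * s `^ (1 + 2 * a)) =
  ((1 + s^-1) `^ a) ^+ 2 - s^-1 * (s `^ a)^-1 *
    ((1 + s^-1) `^ a * (3 / (2 * beta) + a / beta * (1 + s^-1)^-1)).
Proof.
move=> s0; have sV0 : 0 < s^-1 by rewrite invr_gt0.
have y0 : 0 < 1 + s^-1 by rewrite addr_gt0.
have tE : 1 + s = (1 + s^-1) * s by rewrite mulrDl mul1r mulVf ?gt_eqF// addrC.
have tau : (1 + s) `^ a = (1 + s^-1) `^ a * s `^ a by rewrite tE powRM ?ltW.
have ta1 : (1 + s) `^ (a - 1) = (1 + s^-1) `^ a * s `^ a / ((1 + s^-1) * s).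
  rewrite gt0_powRD ?addr_gt0// tau.
  by rewrite powR_inv1 ?tE// mulr_ge0 ?ltW.
have sa : s `^ (1 + 2 * a) = s * (s `^ a) ^+ 2.
  rewrite gt0_powRD// powRr1 ?ltW//.
  by rewrite [2 * a]mulrC powRrM powR_mulrn ?powR_ge0.
rewrite /A1 ta1 tau sa.
have be0 : beta != 0 by rewrite gt_eqF// /beta addr_gt0.
have S0 : s `^ a != 0 by rewrite gt_eqF// powR_gt0.
have Y0 : 1 + s^-1 != 0 by rewrite gt_eqF.
have ss : s != 0 by rewrite gt_eqF.
move: (s `^ a) ((1 + s^-1) `^ a) S0 => S Y S0.
have s10 : s + 1 != 0 by rewrite gt_eqF// addr_gt0.
by field; rewrite be0 S0 s10 ss.
Qed.

Lemma cvg_inv_pinfty : (s^-1 @[s --> +oo] --> (0 : R)).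
Proof.
have H : \forall s \near +oo, (0 : R) < id s by exact: nbhs_pinfty_gt.
exact: ((@gtr0_cvgV0 R R _ _ id H).2 cvg_id).
Qed.

Lemma curvature_ratio_cvg :
  (((1 + s^-1) `^ a) ^+ 2 - s^-1 * (s `^ a)^-1 *
    ((1 + s^-1) `^ a * (3 / (2 * beta) + a / beta * (1 + s^-1)^-1)))
  @[s --> +oo] --> (1 : R).
Proof.
have cy : 1 + s^-1 @[s --> +oo] --> (1 : R).
  by rewrite -[X in _ --> X]addr0; apply: cvgD; [exact: cvg_cst|exact: cvg_inv_pinfty].
have cY : (1 + s^-1) `^ a @[s --> +oo] --> (1 : R).
  have H : {for 1, continuous (fun x : R => x `^ a)}.
    apply/differentiable_continuous/derivable1_diffP.
    by have [] := @is_derive1_powR R a 1 ltr01.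
  by have := cvg_comp _ _ cy H; rewrite powR1.
have cS : s^-1 * (s `^ a)^-1 @[s --> +oo] --> (0 : R).
  apply: (@squeeze_cvgr _ _ _ _ (fun=> 0) (fun s => s^-1)).
  - near=> s.
    have s1 : 1 <= s by near: s; exact: nbhs_pinfty_ge.
    have s0 : 0 <= s by rewrite (le_trans _ s1).
    rewrite mulr_ge0 ?invr_ge0 ?powR_ge0//= ler_piMr ?invr_ge0//.
    rewrite invf_le1 ?powR_gt0 ?(lt_le_trans _ s1)//.
    by rewrite powR_ge1// ltW.
  - exact: cvg_cst.
  - exact: cvg_inv_pinfty.
rewrite [X in _ --> X](_ : 1 = 1 ^+ 2 - 0 * (1 * (3 / (2 * beta) + a / beta * 1^-1)));
  last by rewrite mul0r subr0 expr1n.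
apply: cvgB; first by rewrite expr2; apply: cvgM.
apply: cvgM => //; apply: cvgM => //; apply: cvgD; first exact: cvg_cst.
by apply: cvgM; [exact: cvg_cst|apply: cvgV].
Unshelve. all: by end_near. Qed.

(* [subsol_density = f W] decays like t^(-1 - a), with t = 1 + s, which is also
   the order of its source 4 (s V)' because s V tends to its limit
   [beta * kappa] at the rate t^(-a); this is the effect of the term in [sigma s * sigma s].
   In terms of [tau] and [sigma] all derivatives below are polynomials. *)
Let tau s := (1 + s) `^ (-1).
Let sigma s := (1 + s) `^ (- a).
Let kappa := a * beta.

Definition subsol_density s : R := kappa * (tau s * sigma s) - tau s * (sigma s * sigma s).
Definition subsol s : R := expR (A s) * subsol_density s.
Definition subsol_flux s : R :=
  beta * kappa * tau s - beta * (tau s * sigma s) - beta * kappa * (tau s * (tau s * sigma s))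
  + (1 + 2 * a) * (tau s * (tau s * (sigma s * sigma s))).
Definition subsol1 s : R := expR (A s) * subsol_flux s.
Definition subsol_flux1 s : R :=
  - (beta * kappa) * (tau s * tau s) + beta ^+ 2 * (tau s * (tau s * sigma s))
  + beta * kappa * (2 + a) * (tau s * (tau s * (tau s * sigma s)))
  - (1 + 2 * a) * (2 + 2 * a) * (tau s * (tau s * (tau s * (sigma s * sigma s)))).

Lemma isD_tau s : 0 <= s -> is_derive s 1 tau (- (tau s * tau s)).
Proof.
move=> s0; have := isD_shifted_power (-1) 0 (gtN1 s0).
rewrite (_ : shifted_power _ _ = tau); last by apply/funext => y; rewrite shifted_power0.
move=> /isD_val; apply; rewrite shifted_power1 mulN1r powRD//.
by apply/implyP => _; rewrite gt_eqF// ltr_pwDl.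
Qed.

Lemma isD_sigma s : 0 <= s -> is_derive s 1 sigma (- (a * (tau s * sigma s))).
Proof.
move=> s0; have := isD_shifted_power (- a) 0 (gtN1 s0).
rewrite (_ : shifted_power _ _ = sigma); last by apply/funext => y; rewrite shifted_power0.
move=> /isD_val; apply; rewrite shifted_power1 mulNr powRD 1?[tau s * _]mulrC//.
by apply/implyP => _; rewrite gt_eqF// ltr_pwDl.
Qed.

(** The reason for the factor [sigma] in [subsol_density]: differentiating [expR (A s)] brings down
    [A1 s], which [sigma s] turns into a constant. *)
Lemma A1_sigma s : 0 <= s -> A1 s * sigma s = beta.
Proof.
move=> s0; rewrite /A1 /sigma powRN mulfK// gt_eqF// powR_gt0//.
by rewrite ltr_pwDl.
Qed.

Lemma isD_subsol s : 0 <= s -> is_derive s 1 subsol (subsol1 s).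
Proof.
move=> s0; have dt := isD_tau s0; have ds := isD_sigma s0.
have dE := @isD_comp _ _ A _ _ _ _ _ (is_derive_expR (A s)) (isD_A (gtN1 s0)).
have db := isD_add (isD_mul (isD_cst s 1 kappa) (isD_mul dt ds))
  (isD_opp (isD_mul dt (isD_mul ds ds))).
apply: (isD_val (isD_mul dE db)).
have := A1_sigma s0; rewrite -/(A1 s) /subsol1 /subsol_flux /subsol_density => E.
transitivity (expR (A s) * (A1 s * sigma s * (kappa * tau s - tau s * sigma s)
  + ((1 + 2 * a) * (tau s * (tau s * (sigma s * sigma s)))
     - beta * kappa * (tau s * (tau s * sigma s))))).
  by rewrite /A1 /kappa /beta; ring.
by rewrite E; ring.
Qed.

Lemma isD_subsol_flux s : 0 <= s ->
  is_derive s 1 subsol_flux (subsol_flux1 s).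
Proof.
move=> s0; have dt := isD_tau s0; have ds := isD_sigma s0.
have C c := isD_cst s 1 c.
apply: (isD_val (isD_add (isD_add (isD_add (isD_mul (C _) dt)
  (isD_opp (isD_mul (C _) (isD_mul dt ds))))
  (isD_opp (isD_mul (C _) (isD_mul dt (isD_mul dt ds)))))
  (isD_mul (C _) (isD_mul dt (isD_mul dt (isD_mul ds ds)))))).
by rewrite /subsol_flux1 /beta; ring.
Qed.

Lemma profile_subsol s : profile s * subsol s = subsol_density s.
Proof. by rewrite /profile /subsol mulrA -expRD addNr expR0 mul1r. Qed.

Lemma profile_subsol1 s : profile s * subsol1 s = subsol_flux s.
Proof. by rewrite /profile /subsol1 mulrA -expRD addNr expR0 mul1r. Qed.

Lemma Ck_tau_sigma k : Ck k (fun p => tau (sqnorm p)) /\ Ck k (fun p => sigma (sqnorm p)).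
Proof. by split; exact: powR_smooth. Qed.

Lemma subsol_density_smooth : smooth (fun p => subsol_density (sqnorm p)).
Proof.
move=> k; have [ct cs] := Ck_tau_sigma k.
by repeat first [exact: Ck_cst|exact: ct|exact: cs|apply: CkN|apply: CkM|apply: CkD].
Qed.

Lemma subsol_smooth : smooth (fun p => subsol (sqnorm p)).
Proof.
move=> k; apply: CkM; last exact: subsol_density_smooth.
by apply: expR_smooth => n; apply: CkD; [exact: powR_smooth|exact: Ck_cst].
Qed.

Lemma subsol_flux_smooth : smooth (fun p => subsol_flux (sqnorm p)).
Proof.
move=> k; have [ct cs] := Ck_tau_sigma k.
by repeat first [exact: Ck_cst|exact: ct|exact: cs|apply: CkN|apply: CkM|apply: CkD].
Qed.

Lemma subsol_flux1_smooth : smooth (fun p => subsol_flux1 (sqnorm p)).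
Proof.
move=> k; have [ct cs] := Ck_tau_sigma k.
by repeat first [exact: Ck_cst|exact: ct|exact: cs|apply: CkN|apply: CkM|apply: CkD].
Qed.

(* [c0] bounds the negative terms of [4 (s V)' - f W], which are dominated by
   the leading term, of coefficient [3 * kappa], as soon as [1 + s >= t0];
   [subsol_shift] takes care of smaller [s]. *)
Let c0 := 4 * beta ^+ 2 + 4 * (1 + 2 * a) ^+ 2 + 4 * beta * kappa * (2 + a).
Let t0 := c0 / (3 * kappa).
Definition subsol_shift : R := c0 * expR (t0 `^ beta - 1).

Lemma tau_itv s : 0 <= s -> 0 < tau s <= 1.
Proof.
move=> s0; rewrite /tau powR_inv1 ?addr_ge0// invr_gt0 ltr_pwDl//=.
by rewrite invf_le1 ?lerDl// ltr_pwDl.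
Qed.

Lemma sigma_itv s : 0 <= s -> 0 < sigma s <= 1.
Proof.
move=> s0; rewrite /sigma powRN invr_gt0 powR_gt0/= ?ltr_pwDl//.
by rewrite invf_le1 ?powR_gt0 ?ltr_pwDl// powR_ge1 ?lerDl// ltW.
Qed.

(** The term [- beta * (tau s * sigma s)] of the flux, together with its derivative, contributes 4
    beta a = 4 kappa to the coefficient of tau sigma; the density takes away kappa, which leaves 3
    kappa. All remaining negative terms contain tau^2 sigma. *)
Lemma subsol_ge s : 0 <= s -> tau s * sigma s * (3 * kappa - c0 * tau s) <=
  4 * (subsol_flux s + s * subsol_flux1 s) - subsol_density s.
Proof.
move=> s0; have := tau_itv s0; have := sigma_itv s0.
(* This eliminates [s] and leaves a polynomial inequality in [tau s] and [sigma s], both in ]0,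
   1]. *)
have tsE : tau s * s = 1 - tau s.
  rewrite /tau powR_inv1 ?addr_ge0//; have : 1 + s != 0 by rewrite gt_eqF// ltr_pwDl.
  by move=> ?; field.
rewrite /subsol_flux /subsol_flux1 /subsol_density.
move: (tau s) (sigma s) tsE => x z xs /andP[z0 z1] /andP[x0 x1].
have -> : s * (- (beta * kappa) * (x * x) + beta ^+ 2 * (x * (x * z)) +
    beta * kappa * (2 + a) * (x * (x * (x * z))) -
    (1 + 2 * a) * (2 + 2 * a) * (x * (x * (x * (z * z))))) =
  (1 - x) * (- (beta * kappa) * x + beta ^+ 2 * (x * z) +
    beta * kappa * (2 + a) * (x * (x * z)) -
    (1 + 2 * a) * (2 + 2 * a) * (x * (x * (z * z)))).
  by rewrite -xs; ring.
have be0 : 0 < beta by rewrite /beta addr_gt0.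
have ka0 : 0 < kappa by rewrite /kappa mulr_gt0.
rewrite -subr_ge0.
(* The first summand of [c0] cancels the negative term with coefficient [4 * beta ^+ 2]; the other
   two turn the remaining negative terms into multiples of [1 - z] and [1 - x]. *)
have -> : 4 * (beta * kappa * x - beta * (x * z) - beta * kappa * (x * (x * z)) +
   (1 + 2 * a) * (x * (x * (z * z))) + (1 - x) * (- (beta * kappa) * x + beta ^+ 2 * (x * z) +
    beta * kappa * (2 + a) * (x * (x * z)) -
    (1 + 2 * a) * (2 + 2 * a) * (x * (x * (z * z))))) -
   (kappa * (x * z) - x * (z * z)) - x * z * (3 * kappa - c0 * x) =
  4 * beta * kappa * x ^+ 2 + 4 * beta ^+ 2 * kappa * (x ^+ 2 * z)
  + 4 * (1 + 2 * a) * (2 + 2 * a) * (x ^+ 3 * z ^+ 2) + x * z ^+ 2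
  + 4 * (1 + 2 * a) ^+ 2 * (x ^+ 2 * z * (1 - z))
  + 4 * beta * kappa * (2 + a) * (x ^+ 2 * z * (1 - x)).
  by rewrite /c0 /kappa /beta; ring.
have x1' : 0 <= 1 - x by rewrite subr_ge0.
have z1' : 0 <= 1 - z by rewrite subr_ge0.
have a0 := ltW a_gt0.
by rewrite !addr_ge0// ?mulr_ge0// ?exprn_ge0 ?addr_ge0 ?mulr_ge0// ltW.
Qed.

Lemma subsol_subsolution s : 0 <= s ->
  profile s * (subsol s - subsol_shift) <=
  4 * (subsol_flux s + s * subsol_flux1 s).
Proof.
move=> s0; rewrite mulrBr profile_subsol lerBlDl -lerBlDr -[leLHS]opprB lerNl.
apply: le_trans (subsol_ge s0); rewrite lerNl.
have /andP[x0 x1] := tau_itv s0; have /andP[z0 z1] := sigma_itv s0.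
have be0 : 0 < beta by rewrite /beta addr_gt0.
have ka0 : 0 < kappa by rewrite /kappa mulr_gt0.
have c00 : 0 < c0.
  rewrite /c0 !addr_gt0// ?mulr_gt0 ?exprn_gt0// ?addr_gt0 ?mulr_gt0//.
have P0 : 0 <= profile s * subsol_shift.
  by rewrite mulr_ge0 ?mulr_ge0 ?expR_ge0// ltW.
have taE : tau s = (1 + s)^-1 by rewrite /tau powR_inv1// addr_ge0.
(* Where [t0 <= 1 + s] the lower bound of [subsol_ge] is already nonnegative. Elsewhere the profile
   is at least exp(1 - t0^beta), so its product with the shift is at least [c0], which exceeds the
   defect because [tau] and [sigma] are at most 1. *)
have [tle|tlt] := leP t0 (1 + s).
  apply: le_trans P0; rewrite oppr_le0; apply: mulr_ge0.
    by apply: mulr_ge0; exact: ltW.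
  rewrite subr_ge0.
  rewrite taE ler_pdivrMr ?ltr_pwDl// mulrC.
  by rewrite -ler_pdivrMr// mulr_gt0.
have P1 : c0 <= profile s * subsol_shift.
  rewrite /profile /subsol_shift mulrCA -expRD ler_peMr ?(ltW c00)//.
  have -> : - ((1 + s) `^ (1 + a) - 1) + (t0 `^ beta - 1) =
      t0 `^ beta - (1 + s) `^ beta by rewrite /beta; ring.
  rewrite -[leLHS]expR0 ler_expR subr_ge0.
  have t1 : 0 <= 1 + s by rewrite addr_ge0.
  apply: ge0_ler_powR; rewrite ?nnegrE//; first exact: ltW.
    exact: le_trans t1 (ltW tlt).
  exact: ltW.
apply: le_trans P1; rewrite -mulrN opprB mulrBr lerBlDr.
apply: (@le_trans _ _ c0); last by rewrite lerDl !mulr_ge0// ltW.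
rewrite mulrCA ler_piMr ?(ltW c00)//.
by rewrite mulr_ile1 ?mulr_ge0 ?mulr_ile1// ltW.
Qed.

End profile.

(** * An integrable product majorant on the plane *)

Section decay.
Context {R : realType}.
Local Notation mu := (@lebesgue_measure R).
Local Notation mu2 := (mu \x mu)%E.
Variable a : R.
Hypothesis a_gt0 : 0 < a.

Lemma cvg_powR_pinfty : x `^ a @[x --> +oo] --> +oo.
Proof.
have a0 : a != 0 by rewrite gt_eqF.
apply/cvgryPge => M; near=> x.
have x1 : `|M| `^ a^-1 <= x by near: x; exact: nbhs_pinfty_ge.
apply: (@le_trans _ _ `|M|); first exact: ler_norm.
rewrite -[leLHS]powRr1// -[X in _ `^ X](mulVf a0) powRrM.
apply: ge0_ler_powR; rewrite ?nnegrE ?powR_ge0//; exact: ltW.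
Unshelve. all: by end_near. Qed.

Definition decay (x : R) : R := (1 + `|x|) `^ (- (1 + a)).

Let norm1_gt0 (x : R) : 0 < 1 + `|x|. Proof. by rewrite ltr_pwDl. Qed.

Lemma decay_ge0 x : 0 <= decay x. Proof. exact: powR_ge0. Qed.

Lemma decay_continuous : continuous decay.
Proof.
have -> : decay = (fun y => y `^ (- (1 + a))) \o (fun x : R => 1 + `|x|) by [].
move=> x; apply: continuous_comp.
  by apply: cvgD; [exact: cvg_cst|exact: norm_continuous].
apply/differentiable_continuous/derivable1_diffP.
by have [] := @is_derive1_powR R (- (1 + a)) _ (norm1_gt0 x).
Qed.

Lemma decay_integral_half : (\int[mu]_(x in `[0%R, +oo[) (decay x)%:E < +oo)%E.
Proof.
pose F x := - ((1 + x) `^ (- a) / a).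
have dF (x : R) : 0 <= x -> is_derive x 1 F (decay x).
  move=> x0; have x1 : -1 < x by rewrite (lt_le_trans _ x0)// ltrN10.
  have := isD_opp (isD_mul (isD_shifted_power (- a) 0 x1) (isD_cst x 1 a^-1)).
  rewrite (_ : (fun _ => _) = F); last first.
    by apply/funext => y; rewrite shifted_power0.
  move=> /isD_val; apply; rewrite mulr0 addr0 shifted_power1 /decay ger0_norm//.
  rewrite mulNr mulNr opprK mulrAC divff ?gt_eqF// mul1r.
  by congr (_ `^ _); rewrite opprD addrC.
rewrite (@ge0_continuous_FTC2y _ decay F 0 0) ?sub0r ?ltry//.
- by move=> x _; exact: decay_ge0.
- exact: continuous_subspaceT decay_continuous.
- rewrite -oppr0; apply: cvgN; rewrite -(mul0r a^-1); apply: cvgM; last exact: cvg_cst.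
  rewrite (_ : (fun x => (1 + x) `^ (- a)) = fun x => ((1 + x) `^ a)^-1); last first.
    by apply/funext => x; rewrite powRN.
  apply/gtr0_cvgV0.
    near=> x; apply: powR_gt0; exact: addr_gt0.
  exact: (cvg_comp _ _ (cvg_addrl 1) cvg_powR_pinfty).
- by move=> x /ltW x0; have [] := dF x x0.
- apply: cvg_at_right_filter.
  by apply/differentiable_continuous/derivable1_diffP; have [] := dF 0 (lexx _).
- move=> x; rewrite in_itv/= andbT => /ltW x0.
  by have [_ <-] := dF x x0; rewrite derive1E.
Unshelve. all: by end_near. Qed.

Lemma decay_integral : (\int[mu]_x (decay x)%:E < +oo)%E.
Proof.
rewrite ge0_symfun_integralT; last 3 first.
- exact: decay_ge0.
- exact: decay_continuous.
- by move=> x; rewrite /decay /= normrN.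
apply: lte_mul_pinfty => //.
rewrite (_ : [set x | _] = `[0%R, +oo[%classic); first exact: decay_integral_half.
by apply/seteqP; split=> x /=; rewrite in_itv/= andbT.
Qed.

Lemma decay2_integrable :
  mu2.-integrable setT (EFin \o (fun p => decay p.1 * decay p.2)).
Proof.
have cd : continuous (fun p : R * R => decay p.1 * decay p.2).
  move=> p; apply: cvgM.
    by apply: continuous_comp; [exact: cvg_fst|exact: decay_continuous].
  by apply: continuous_comp; [exact: cvg_snd|exact: decay_continuous].
have mE := (measurable_EFinP _ _).2 (continuous_measurable_plane cd).
have md : measurable_fun [set: measurableTypeR R] (EFin \o decay).
  apply/measurable_EFinP; exact: (continuous_measurable_fun decay_continuous).
apply/integrableP; split; first exact: mE.
under eq_integral do rewrite /= ger0_norm ?mulr_ge0 ?decay_ge0//.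
rewrite fubini_tonelli1//; last first.
  by move=> p; rewrite /= lee_fin mulr_ge0 ?decay_ge0.
have I0 : (0 <= \int[mu]_x (decay x)%:E)%E.
  by apply: integral_ge0 => x _; rewrite lee_fin decay_ge0.
rewrite [X in (X < _)%E](_ : _ =
    (\int[mu]_x ((decay x)%:E * \int[mu]_y (decay y)%:E))%E); last first.
  apply: eq_integral => x _.
  rewrite /fubini_F /= -ge0_integralZl// ?lee_fin ?decay_ge0//.
  by move=> y _; rewrite lee_fin decay_ge0.
rewrite ge0_integralZr//; last by move=> x _; rewrite lee_fin decay_ge0.
apply: lte_mul_pinfty => //; last exact: decay_integral.
by rewrite ge0_fin_numE// decay_integral.
Qed.

(** Trading the radial bound for a product lets Tonelli reduce integrability to one variable,
    without polar coordinates. With x = |p.1| and y = |p.2|, it rests on (1 + x)(1 + y) <= 2 (1 +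
    x^2 + y^2). *)
Lemma powR_le_decay (p : R * R) :
  (1 + sqnorm p) `^ (- (1 + a)) <= 2 `^ (1 + a) * (decay p.1 * decay p.2).
Proof.
have b0 : 0 <= 1 + a by rewrite addr_ge0// ltW.
have s0 := sqnorm_ge0 p.
have t0 : 0 < 1 + sqnorm p by rewrite ltr_pwDl.
have n1 := norm1_gt0 p.1; have n2 := norm1_gt0 p.2.
have n12 : 0 < (1 + `|p.1|) * (1 + `|p.2|) by rewrite mulr_gt0.
rewrite /decay !powRN -invfM -(powRM _ (ltW n1) (ltW n2)).
rewrite ler_pdivlMr ?powR_gt0// mulrC ler_pdivrMr ?powR_gt0//.
rewrite -(powRM _ _ (ltW t0))//; apply: ge0_ler_powR; rewrite ?nnegrE//.
  by rewrite mulr_ge0// ltW.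
have N1 : `|p.1| * `|p.1| = p.1 * p.1 by rewrite -!expr2 real_normK ?num_real.
have N2 : `|p.2| * `|p.2| = p.2 * p.2 by rewrite -!expr2 real_normK ?num_real.
rewrite /sqnorm -N1 -N2.
rewrite -subr_ge0.
have := sqr_ge0 (`|p.1| - `|p.2|).
have := sqr_ge0 (`|p.1| - 1); have := sqr_ge0 (`|p.2| - 1).
move: (`|p.1|) (`|p.2|) => x y.
by nra.
Qed.

End decay.

(** * Failure of positivity preservation, and the curvature asymptotics *)

Section counterexample.
Context {R : realType}.
Local Notation mu := (@lebesgue_measure R).
Local Notation mu2 := (mu \x mu)%E.
Variable a : R.
Hypothesis a_gt0 : 0 < a.
Implicit Types (s : R) (p : R * R).

Let g := profile_metric a_gt0.
Let M := subsol_shift a.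
Let u p := M - subsol a (sqnorm p).

(** From 1 + x <= exp x at x = (1 + s)^(1 + a) - 1. Crude, but of the same order as the bound on
    [subsol_density], so that one majorant serves both. *)
Lemma profile_le s : 0 <= s -> profile a s <= (1 + s) `^ (- (1 + a)).
Proof.
move=> s0; rewrite /profile expRN powRN lef_pV2 ?posrE ?expR_gt0//.
  by apply: le_trans (expR_ge1Dx _); rewrite addrCA subrr addr0.
by rewrite powR_gt0// ltr_pwDl.
Qed.

Lemma subsol_densityE s : 0 <= s -> subsol_density a s =
  (1 + s) `^ (- (1 + a)) * (a * (1 + a) - (1 + s) `^ (- a)).
Proof.
move=> s0; rewrite opprD gt0_powRD ?ltr_pwDl// /subsol_density.
by ring.
Qed.

Lemma subsol_density_norm s : 0 <= s ->
  `|subsol_density a s| <= (a * (1 + a) + 1) * (1 + s) `^ (- (1 + a)).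
Proof.
move=> s0; rewrite subsol_densityE// normrM [leRHS]mulrC ger0_norm ?powR_ge0//.
apply: ler_wpM2l; first exact: powR_ge0.
apply: le_trans (ler_normB _ _) _.
have k0 : 0 <= a * (1 + a) by rewrite mulr_ge0 ?addr_ge0// ltW.
rewrite (ger0_norm k0) lerD2l.
by have /andP[z0 z1] := sigma_itv a_gt0 s0; rewrite ger0_norm// ltW.
Qed.

Lemma subsol_shift_ge0 : 0 <= M.
Proof.
rewrite /M /subsol_shift; apply: mulr_ge0; last exact: expR_ge0.
have a0 := ltW a_gt0.
by rewrite !addr_ge0 ?mulr_ge0 ?exprn_ge0 ?addr_ge0 ?mulr_ge0.
Qed.

Lemma counterexample_continuous : continuous u.
Proof.
move=> p; apply: cvgB; first exact: cvg_cst.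
exact: (Ck_continuous (subsol_smooth a 0)).
Qed.

Lemma sqrt_det_profile p : sqrt_det g p = profile a (sqnorm p).
Proof. exact: sqrt_det_radial. Qed.

(** The density of the measure cancels the exponential in [subsol], so [u] times the density is [M]
    times the profile minus [subsol_density]. *)
Lemma counterexample_integrable : (riemannian_measure g).-integrable setT (EFin \o u).
Proof.
have mu_ := continuous_measurable_plane counterexample_continuous.
apply: (@integrable_density _ _ _ mu2 (riemannian_measure g) (sqrt_det g)) => //.
  by move=> p; exact: sqrtr_ge0.
  exact: measurable_sqrt_det.
pose c := (M + (a * (1 + a) + 1)) * 2 `^ (1 + a).
apply: (@le_integrable _ _ _ mu2 setT _ _ (fun p => (c%:E * (EFin \o (fun p => decay a p.1 * decay a p.2)%R) p)%E)) => //.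
- by apply/measurable_EFinP; apply: measurable_funM => //; exact: measurable_sqrt_det.
- move=> p _; rewrite /= lee_fin sqrt_det_profile mulrBl [subsol _ _ * _]mulrC profile_subsol.
  have s0 := sqnorm_ge0 p; have M0 := subsol_shift_ge0.
  have d0 : 0 <= decay a p.1 * decay a p.2 by rewrite mulr_ge0 ?decay_ge0.
  have k0 : 0 <= a * (1 + a) + 1 by rewrite addr_ge0// mulr_ge0 ?addr_ge0// ltW.
  rewrite [leRHS]ger0_norm; last first.
    by apply: mulr_ge0 => //; apply: mulr_ge0; [exact: addr_ge0|exact: powR_ge0].
  apply: le_trans (ler_normB _ _) _; rewrite normrM (ger0_norm M0) (ger0_norm (ltW (profile_gt0 _ _))).
  apply: (@le_trans _ _ ((M + (a * (1 + a) + 1)) * (1 + sqnorm p) `^ (- (1 + a)))).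
    rewrite mulrDl; apply: lerD; last exact: subsol_density_norm.
    by apply: ler_wpM2l => //; exact: profile_le.
  rewrite -mulrA; apply: ler_wpM2l; first exact: addr_ge0.
  exact: powR_le_decay.
- exact: integrableZl (decay2_integrable a_gt0).
Qed.

Lemma counterexample_supersolution : distributional_supersolution g u.
Proof.
have E : (fun s => profile a s * subsol1 a s) = subsol_flux a.
  by apply/funext => s; exact: profile_subsol1.
have dW s : 0 <= s -> is_derive s 1 (subsol a) (subsol1 a s) by exact: isD_subsol.
have dV s : 0 <= s -> is_derive s 1 (fun s => profile a s * subsol1 a s)
    (subsol_flux1 a s) by rewrite E; exact: isD_subsol_flux.
have sV : smooth (fun p => (fun s => profile a s * subsol1 a s) (sqnorm p)).
  rewrite (_ : (fun p => _) = fun p => subsol_flux a (sqnorm p)).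
    exact: subsol_flux_smooth.
  by apply/funext => p; exact: profile_subsol1.
have ineq s : 0 <= s -> profile a s * (subsol a s - M) <=
    4 * ((fun s => profile a s * subsol1 a s) s + s * subsol_flux1 a s).
  by rewrite profile_subsol1; exact: subsol_subsolution.
have := @radial_supersolution R (profile a) (metric_coef a)
  (@profile_gt0 R a) (@metric_coefE R a a_gt0) (metric_coef_smooth a_gt0)
  (profile_smooth a) (profileV_smooth a) (subsol a) (subsol1 a) (subsol_flux1 a) M
  dW dV (subsol_smooth a) sV (Ck_continuous (subsol_flux1_smooth a 0)) ineq.
exact.
Qed.

(** With z = (1 + s)^(1 + a), the density is at least k / (2 z) once (1 + s)^(-a) <= k / 2, and
    exp(z - 1) >= z^2 / 4; hence [subsol] is at least k z / 8 >= k s / 8. This dictates the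
    thresholds [2 / k] and [8 * M / k]. *)
Lemma subsol_pinfty : exists2 S : R, 1 <= S & forall s, S <= s -> M < subsol a s.
Proof.
pose k := a * (1 + a); have k0 : 0 < k by rewrite mulr_gt0 ?addr_gt0.
have [S0 [_ HS]] : \forall s \near +oo, 2 / k < s `^ a.
  by move/cvgryPgt : (cvg_powR_pinfty a_gt0); exact.
pose S := Num.max (Num.max 1 (`|S0| + 1)) (8 * M / k + 1).
exists S; first by rewrite !le_max lexx.
move=> s Ss.
have s1 : 1 <= s by apply: le_trans Ss; rewrite !le_max lexx.
have sS0 : S0 < s.
  apply: lt_le_trans Ss; rewrite !lt_max; apply/orP; left; apply/orP; right.
  by rewrite ltr_pwDr// ler_norm.
have sM : 8 * M / k < s.
  by apply: lt_le_trans Ss; rewrite lt_max ltrDl ltr01 orbT.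
have s0 : 0 <= s by rewrite (le_trans _ s1).
have t1 : 1 <= 1 + s by rewrite lerDl.
set z := (1 + s) `^ (1 + a).
have zs : s <= z.
  rewrite /z gt0_powRD ?ltr_pwDl// powRr1 ?addr_ge0//.
  rewrite (@le_trans _ _ (1 + s))// ?lerDr// ler_peMr ?addr_ge0//.
  by rewrite powR_ge1// ltW.
have b_ge : k / 2 / z <= subsol_density a s.
  rewrite subsol_densityE// powRN -/z mulrC.
  apply: ler_wpM2l; first by rewrite invr_ge0 powR_ge0.
  have si : (1 + s) `^ (- a) <= k / 2.
    rewrite powRN -[leRHS]invrK lef_pV2 ?posrE ?invr_gt0 ?divr_gt0//; last first.
      by rewrite powR_gt0// ltr_pwDl.
    rewrite invf_div; apply: (@le_trans _ _ (s `^ a)); first exact/ltW/HS.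
    by apply: ge0_ler_powR; rewrite ?nnegrE ?addr_ge0 ?lerDr// ltW.
  by rewrite -/k lerBrDr; lra.
(* The square of 1 + x <= exp x at x = (z - 1) / 2. *)
have E_ge : z ^+ 2 / 4 <= expR (z - 1).
  have -> : z - 1 = (z - 1) / 2 + (z - 1) / 2 by field.
  rewrite expRD -expr2.
  have := expR_ge1Dx ((z - 1) / 2); have z1 : 0 <= z by exact: powR_ge0.
  by move=> ?; nra.
have z0 : 0 < z by rewrite (lt_le_trans _ zs)// (lt_le_trans _ s1).
rewrite /subsol -/z; apply: (@lt_le_trans _ _ (z ^+ 2 / 4 * (k / 2 / z))).
  have -> : z ^+ 2 / 4 * (k / 2 / z) = z * k / 8.
    by field; rewrite gt_eqF.
  rewrite ltr_pdivlMr// mulrC -ltr_pdivrMr//.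
  exact: lt_le_trans zs.
by apply: ler_pM => //; rewrite ?divr_ge0 ?exprn_ge0 ?ltW.
Qed.

Lemma counterexample_not_ae_ge0 : ~ {ae riemannian_measure g, forall p, 0 <= u p}.
Proof.
move=> [B [mB B0 uB]].
have [S S1 HS] := subsol_pinfty.
(* On this square [p.1 >= S >= 1], hence [sqnorm p >= S] and [u p < 0]. The density is bounded below
   there by the constant [c] chosen further down, so the square has positive area. *)
pose Q : set (measurableTypeR R * measurableTypeR R) :=
  `[S, S + 1]%classic `*` `[0, 1]%classic.
have mQ : measurable Q by apply: measurableX; exact: measurable_itv.
have QB : Q `<=` B.
  move=> p [/=]; rewrite !in_itv/= => /andP[p1 _] _; apply: uB => /=.
  rewrite subr_ge0 leNgt => /negP; apply; apply: HS.
  rewrite /sqnorm; apply: (@le_trans _ _ (p.1 * p.1)); last by rewrite lerDl -expr2 sqr_ge0.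
  have p11 : 1 <= p.1 := le_trans S1 p1.
  by rewrite (le_trans p1)// ler_peMl// (le_trans _ p11).
have Q0 : riemannian_measure g Q = 0%E.
  apply/eqP; rewrite -measure_le0 -[leRHS]B0.
  by apply: le_measure; rewrite ?inE.
pose c := profile a ((S + 1) * (S + 1) + 1).
have c0 : 0 < c by exact: profile_gt0.
have : (c%:E * mu2 Q <= riemannian_measure g Q)%E.
  rewrite -integral_cst//; apply: ge0_le_integral => //.
  - by move=> p _; rewrite lee_fin ltW.
  - by apply/measurable_EFinP/measurable_funTS; exact: measurable_sqrt_det.
  move=> p [/=]; rewrite !in_itv/= => /andP[p1 p1'] /andP[p2 p2'].
  rewrite lee_fin sqrt_det_profile /c /profile ler_expR lerN2 lerD2r.
  have p10 : 0 <= p.1 by rewrite (le_trans _ p1)// (le_trans _ S1).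
  have S0 : 0 <= S by rewrite (le_trans _ S1).
  have tT : 1 + sqnorm p <= 1 + ((S + 1) * (S + 1) + 1).
    by rewrite lerD2l /sqnorm lerD// ?ler_pM// mulr_ile1.
  have t0 : 0 <= 1 + sqnorm p by rewrite addr_ge0// sqnorm_ge0.
  apply: ge0_ler_powR; rewrite ?nnegrE//; first by rewrite addr_ge0// ltW.
  exact: le_trans tT.
have m1 : measurable (`[S, S + 1]%classic : set (measurableTypeR R)).
  exact: measurable_itv.
have m2 : measurable (`[0, 1]%classic : set (measurableTypeR R)).
  exact: measurable_itv.
have : (mu `[S, (S + 1)%R] * mu `[0%R, 1%R] = 1)%E.
  rewrite !lebesgue_measure_itv/= !lte_fin ltr01 ltrDl ltr01 -!EFinB -!EFinM.
  by rewrite subr0 mulr1 addrAC subrr add0r.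
rewrite -(product_measure1E _ _ m1 m2) => Q1.
by rewrite Q0 [X in (_ * X)%E]Q1 mule1 lee_fin leNgt c0.
Qed.

Lemma profile_not_L1_positivity : ~ L1_positivity_preserving g.
Proof. by move=> H; exact: counterexample_not_ae_ge0 (H u counterexample_integrable counterexample_supersolution). Qed.

Lemma profile_pole : is_pole g 0.
Proof. exact: (radial_pole _ _ (isD_metric_coef a_gt0)). Qed.

Lemma profile_curvature_asymptotic :
  asymptotically_equivalent (riemannian_distance g 0) (gauss_curvature g)
    (fun p => - (4 * (1 + a) ^+ 2) * riemannian_distance g 0 p `^ (2 + 4 * a)).
Proof.
move=> U /(curvature_ratio_cvg a_gt0)[S [_ HS]].
(* A radius r beyond [|S| + 1] exceeds both S and 1, so r^2 >= r > S. *)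
exists (`|S| + 1) => // p /=; rewrite radial_distance => Sp.
have S1 : 1 < Num.sqrt (sqnorm p) by apply: le_lt_trans Sp; rewrite lerDr.
have s0 : 0 < sqnorm p by rewrite -sqrtr_gt0 (lt_trans _ S1).
have Ss : S < sqnorm p.
  rewrite -[ltRHS](sqr_sqrtr (ltW s0)) expr2.
  apply: (@lt_le_trans _ _ (Num.sqrt (sqnorm p))).
    by apply: lt_trans Sp; rewrite ltr_pwDr// ler_norm.
  by rewrite ler_peMl ?sqrtr_ge0// ltW.
rewrite /preimage/= gauss_curvature_profile//.
have -> : Num.sqrt (sqnorm p) `^ (2 + 4 * a) = sqnorm p `^ (1 + 2 * a).
  rewrite -powR12_sqrt ?sqnorm_ge0// -powRrM; congr (_ `^ _).
  by field.
by rewrite curvature_ratio//; exact: HS.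
Qed.

End counterexample.

Theorem theoremB (R : realType) (eps : R) (eps_gt0 : 0 < eps) :
  exists (g : riemannian_metric R) (o : R * R),
    [/\ is_pole g o,
        exists2 C : R, 0 < C &
          asymptotically_equivalent (riemannian_distance g o)
            (gauss_curvature g)
            (fun x => - C * riemannian_distance g o x `^ (2 + eps)) &
        ~ L1_positivity_preserving g].
Proof.
have a_gt0 : 0 < eps / 4 by rewrite divr_gt0.
exists (profile_metric a_gt0), 0; split.
- exact: profile_pole.
- exists (4 * (1 + eps / 4) ^+ 2).
    by rewrite mulr_gt0// exprn_gt0// addr_gt0.
  have -> : 2 + eps = 2 + 4 * (eps / 4) by field.
  exact: profile_curvature_asymptotic.
- exact: profile_not_L1_positivity.
Qed.
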